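(* For every $n\geq 1$, the $S_\infty$-space $\mathrm{Mod}_\omega(\widehat{\mathcal{B}_n})$ is $(n-1)$-dimensional and locally generically $(n-1)$-dimensional.
   Context: BKL$_n$-structures. For $n\ge1$, $\mathcal{L}_n$ is the language with $n$-ary function symbols $s_i$ ($i\in\omega$) and $n$-ary relation symbols $R_j$ ($j\in\omega$). A BKL$_n$-structure is an $\mathcal{L}_n$-structure $A$ (possibly empty) such that: (B1) the relations $(R_j)_{j\in\omega}$ partition $A^n$; (B2) if $a=(a_0,\dots,a_{n-1})$ satisfies $R_j$, then $s_i(a)=a_0$ for all $i>j$; (B3) for every $B\subseteq A$ with $|B|=n+1$ there is $b\in B$ lying in the substructure generated by $B\setminus\{b\}$; (B4) $A$ is locally finite, i.e. every finitely generated substructure is finite. $\mathcal{B}_n$ is the class of all BKL$_n$-structures. Labeled structures. For a countable language $\mathcal{L}$, let $\widehat{\mathcal{L}}=\mathcal{L}\cup\{P_i\mid i\in\omega\}$ with $P_i$ new unary relation symbols. For a class $\mathcal{K}$ of $\mathcal{L}$-structures, $\widehat{\mathcal{K}}$ is the class of $\widehat{\mathcal{L}}$-structures whose reduct to $\mathcal{L}$ is in $\mathcal{K}$ and in which no two distinct elements satisfy exactly the same predicates $P_i$. Spaces of structures. $\mathcal{X}_{\mathcal{L}}$ is the Polish space of all $\mathcal{L}$-structures with domain $\omega$, with subbasis the sets $\{A\mid A\models R(a)\}$, $\{A\mid A\models\lnot R(a)\}$, $\{A\mid A\models f(a)=b\}$, for $R,f$ relation and function symbols of $\mathcal{L}$,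 $a$ a tuple from $\omega$ of the right length and $b\in\omega$. $S_\infty$ is the Polish group of all bijections of $\omega$ with the pointwise convergence topology; it acts continuously on $\mathcal{X}_{\mathcal{L}}$ by the logic action: $gA=B$ iff $g$ is an isomorphism $A\to B$. $\mathrm{Mod}_\omega(\mathcal{K})$ is the subspace of structures in $\mathcal{X}_{\mathcal{L}}$ belonging to $\mathcal{K}$. $\mathrm{Mod}_\omega(\widehat{\mathcal{B}_n})$ is an invariant $G_\delta$ subspace of $\mathcal{X}_{\widehat{\mathcal{L}_n}}$, hence a Polish $S_\infty$-space. Becker digraph. A sequence $(g_n)$ in a Polish group $G$ is right-Cauchy if it is Cauchy for some (equivalently, any) compatible right-invariant metric. In a Polish $G$-space $X$, $x$ right-embeds in $x'$ if there is a right-Cauchy sequence $(g_n)$ in $G$ with $g_nx'\to x$. For $G$-invariant $C\subseteq X$, $\mathcal{B}(C/G)$ is the digraph whose vertices are the orbits $[x]$, $x\in C$, with an arrow $[x]\to[x']$ iff $x$ right-embeds in $x'$. Dimension. The combinatorial $m$-cube ($m\ge 0$) is the digraph on the powerset of $\{0,\dots,m-1\}$ with an arrow $\sigma\to\tau$ iff $\sigma\subseteq\tau$. A digraph embedding is an injection that preserves and reflects arrows. For a non-empty $G$-invariant $C\subseteq X$, the dimension of $C$ is the largest $m\geq0$ such that the combinatorial $m$-cube embeds in $\mathcal{B}(C/G)$ if such a largest $m$ exists, and $\infty$ otherwise. $X$ is $m$-dimensional if its dimension is $m$. $X$ is locally generically $m$-dimensional if $m$ is the largest element of $\{0,1,\dots\}\cup\{\infty\}$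 such that every invariant non-meager subset of $X$ with the Baire property has dimension at least $m$. *)

(* Defs.v *)
From HB Require Import structures.
From mathcomp Require Import all_boot all_order all_algebra.
From mathcomp Require Import monoid finmap.
From mathcomp Require Import boolp classical_sets functions cardinality.
From mathcomp Require Import reals topology.
Set Implicit Arguments.
Unset Strict Implicit.
Unset Printing Implicit Defensive.
Local Open Scope classical_set_scope.

HB.mixin Record Group_isTopGroup G of Group G & Topological G := {
  mulg_continuous : continuous (fun p : G * G => (p.1 * p.2)%g) ;
  invg_continuous : continuous (fun g : G => g^-1%g)
}.

#[short(type="topGroupType")]
HB.structure Definition TopGroup :=
  { G of Group G & Topological G & Group_isTopGroup G }.

(* No definition below uses that the group or the space is Polish. *)
Record gspace (G : topGroupType) := GSpace {
  gcarrier :> topologicalType ;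
  gact : G -> gcarrier -> gcarrier ;
  gact1 : forall x, gact 1%g x = x ;
  gactM : forall g h x, gact (g * h)%g x = gact g (gact h x) ;
  gact_continuous : continuous (fun p : G * gcarrier => gact p.1 p.2)
}.
Arguments gact {G} X g x : rename.

Section metric.
Context {R : realType} {G : topGroupType}.
Local Open Scope ring_scope.

Definition is_metric (d : G -> G -> R) : Prop :=
  [/\ forall x y, 0 <= d x y,
      forall x y, d x y = 0 <-> x = y,
      forall x y, d x y = d y x &
      forall x y z, d x z <= d x y + d y z].

Definition compatible_metric (d : G -> G -> R) : Prop :=
  forall x (U : set G),
    nbhs x U <-> exists2 e, 0 < e & [set y | d x y < e] `<=` U.

Definition right_invariant_metric (d : G -> G -> R) : Prop :=
  forall g x y, d (x * g)%g (y * g)%g = d x y.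

Definition cauchy_for (d : G -> G -> R) (g : nat -> G) : Prop :=
  forall e, 0 < e ->
    exists N, forall i j, (N <= i)%N -> (N <= j)%N -> d (g i) (g j) < e.

End metric.

Definition right_cauchy (R : realType) (G : topGroupType) (g : nat -> G) :=
  exists d : G -> G -> R,
    [/\ is_metric d, compatible_metric d, right_invariant_metric d
      & cauchy_for d g].

Record digraph := Digraph {
  vertex :> Type ;
  arrow : vertex -> vertex -> Prop
}.

Definition digraph_embeds (D E : digraph) : Prop :=
  exists2 f : D -> E, injective f & forall x y, arrow x y <-> arrow (f x) (f y).

Definition cube (m : nat) : digraph :=
  @Digraph {set 'I_m} (fun s t => s \subset t).

Inductive extnat := Fin of nat | Infty.

Definition le_extnat (d e : extnat) : bool :=
  match d, e with
  | _, Infty => true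
  | Infty, Fin _ => false
  | Fin k, Fin m => k <= m
  end.

Section topology.
Context {T : topologicalType}.

Definition nowhere_dense (A : set T) : Prop := interior (closure A) = set0.

Definition meager (A : set T) : Prop :=
  exists2 F : nat -> set T, forall i, nowhere_dense (F i) &
    A `<=` \bigcup_i F i.

Definition baire_property (A : set T) : Prop :=
  exists2 U : set T, open U & meager (A `+` U).

End topology.

Section gspace.
Context (R : realType) {G : topGroupType} (X : gspace G).

Definition gorbit (x : X) : set X := [set gact X g x | g in setT].

Definition act_invariant (C : set X) : Prop := forall g x, C x -> C (gact X g x).

Definition right_embeds (x x' : X) : Prop :=
  exists2 g : nat -> G, right_cauchy R g & (gact X (g i) x' @[i --> \oo] --> x).

(* Vertices are the orbits of elements of C; the arrow does not depend on the
   choice of the representatives x and x'. *)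
Definition becker (C : set X) : digraph :=
  @Digraph [set gorbit x | x in C]
    (fun O O' => exists x x', [/\ \val O x, \val O' x' & right_embeds x x']).

Definition largest_cube (C : set X) (m : nat) : Prop :=
  digraph_embeds (cube m) (becker C) /\
  forall k, digraph_embeds (cube k) (becker C) -> k <= m.

(* The relation "the dimension of C is d", meant for nonempty invariant C;
   every such C has exactly one dimension d. *)
Definition has_dimension (C : set X) (d : extnat) : Prop :=
  match d with
  | Fin m => largest_cube C m
  | Infty => ~ exists m, largest_cube C m
  end.

Definition is_dimensional (d : extnat) : Prop := has_dimension setT d.

Definition generic_lower_bound (d : extnat) : Prop :=
  forall C : set X, act_invariant C -> ~ meager C -> baire_property C ->
    exists2 e, has_dimension C e & le_extnat d e.

Definition locally_generically_dimensional (d : extnat) : Prop :=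
  generic_lower_bound d /\ forall e, generic_lower_bound e -> le_extnat e d.

End gspace.

(* Bijections of nat as a subspace of nat -> nat with the topology of pointwise
   convergence; the product is composition, (g * h) k = g (h k), so that the
   logic action below is a left action. *)

Definition perms : set {ptws nat -> nat} := [set f | bijective f].
Definition Sinf : Type := set_type perms.
HB.instance Definition _ := Topological.copy Sinf (set_type perms).

Definition Sinf_fun (g : Sinf) : nat -> nat := \val g.
Coercion Sinf_fun : Sinf >-> Funclass.

Lemma Sinf_bij (g : Sinf) : bijective g.
Proof. exact: set_mem (valP g). Qed.

Definition mkSinf (f : nat -> nat) (bf : bijective f) : Sinf :=
  exist _ (f : {ptws nat -> nat}) (mem_set (bf : perms f)).

Lemma SinfP (g h : Sinf) : (forall k, g k = h k) -> g = h.
Proof. by move=> gh; apply: val_inj; apply/funext. Qed.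

Lemma Sinf_inv_subproof (g : Sinf) :
  exists h : nat -> nat, cancel g h /\ cancel h g.
Proof. by have [h gK hK] := Sinf_bij g; exists h. Qed.

Definition Sinf_inv_fun (g : Sinf) : nat -> nat :=
  projT1 (cid (Sinf_inv_subproof g)).

Lemma Sinf_invK (g : Sinf) : cancel g (Sinf_inv_fun g).
Proof. by rewrite /Sinf_inv_fun; case: cid => h []. Qed.

Lemma Sinf_invVK (g : Sinf) : cancel (Sinf_inv_fun g) g.
Proof. by rewrite /Sinf_inv_fun; case: cid => h []. Qed.

Definition Sinf_one : Sinf := mkSinf (Bijective (frefl id) (frefl id)).
Definition Sinf_mul (g h : Sinf) : Sinf :=
  mkSinf (bij_comp (Sinf_bij g) (Sinf_bij h)).
Definition Sinf_inv (g : Sinf) : Sinf :=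
  mkSinf (Bijective (Sinf_invVK g) (Sinf_invK g)).

Lemma Sinf_mulA : associative Sinf_mul.
Proof. by move=> f g h; apply: SinfP. Qed.
Lemma Sinf_mul1g : left_id Sinf_one Sinf_mul.
Proof. by move=> g; apply: SinfP. Qed.
Lemma Sinf_mulg1 : right_id Sinf_one Sinf_mul.
Proof. by move=> g; apply: SinfP. Qed.
Lemma Sinf_mulVg : left_inverse Sinf_one Sinf_inv Sinf_mul.
Proof. by move=> g; apply: SinfP => k; exact: Sinf_invK. Qed.
Lemma Sinf_mulgV : right_inverse Sinf_one Sinf_inv Sinf_mul.
Proof. by move=> g; apply: SinfP => k; exact: Sinf_invVK. Qed.

HB.instance Definition _ := isGroup.Build Sinf
  Sinf_mulA Sinf_mul1g Sinf_mulg1 Sinf_mulVg Sinf_mulgV.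

Lemma Sinf_mulE (g h : Sinf) k : ((g * h)%g : Sinf) k = g (h k). Proof. by []. Qed.

Lemma Sinf_cvgP (F : set_system Sinf) {FF : Filter F} (g : Sinf) :
  F --> g <-> forall k, F [set h | h k = g k].
Proof.
split=> [Fg k|Fg].
  apply: Fg; exists [set h : Sinf | h k = g k]; split => //.
  exists [set f : {ptws nat -> nat} | f k = g k] => //.
  apply: (open_comp (f := fun f : {ptws nat -> nat} => f k) (D := [set g k])).
    by move=> f _; exact: (@proj_continuous nat (fun=> nat) k).
  exact: discrete_open.
move=> U [V [[W oW <-] Wg] VU].
apply: (filterS VU).
have : nbhs (\val g : {ptws nat -> nat}) W by exact: open_nbhs_nbhs.
suff : (\val @ F) --> (\val g : {ptws nat -> nat}) by apply.
apply/cvg_sup => i; apply/cvg_image.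
  by apply/seteqP; split => // y _; exists (fun=> y).
move=> A /=; rewrite nbhs_principalE /= => Ag.
exists [set f : nat -> nat | A (f i)]; last first.
  apply/seteqP; split => [_ [f Af <-] //|y Ay]; by exists (fun=> y).
apply: filterS (Fg i) => h hi; change (A (h i)); rewrite hi.
exact/principal_filterP.
Qed.

Lemma Sinf_near (g : Sinf) k : nbhs g [set h | h k = g k].
Proof. by move: k; apply: (proj1 (@Sinf_cvgP (nbhs g) _ g)). Qed.

Lemma Sinf_mulg_continuous : continuous (fun p : Sinf * Sinf => (p.1 * p.2)%g).
Proof.
move=> [g h]; refine (proj2 (@Sinf_cvgP _ _ (g * h)%g) _) => k.
have g1 : nbhs ((g, h) : Sinf * Sinf) [set p | Sinf_fun p.1 (Sinf_fun h k) = Sinf_fun g (Sinf_fun h k)].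
  exact: (cvg_fst (Sinf_near g (Sinf_fun h k))).
have h1 : nbhs ((g, h) : Sinf * Sinf) [set p | Sinf_fun p.2 k = Sinf_fun h k].
  exact: (cvg_snd (Sinf_near h k)).
apply: filterS (filterI g1 h1) => -[a b] [/= ag bh].
by change (Sinf_fun a (Sinf_fun b k) = Sinf_fun g (Sinf_fun h k)); rewrite bh.
Qed.

Lemma Sinf_invg_continuous : continuous (fun g : Sinf => g^-1%g).
Proof.
move=> g; refine (proj2 (@Sinf_cvgP _ (fmap_filter _ (nbhs_filter g)) (g^-1)%g) _) => k.
move: (Sinf_near g (Sinf_inv g k)).
apply: (@filterS _ (nbhs g) (nbhs_filter g)) => h /= hk.
change (Sinf_inv h k = Sinf_inv g k).
have {1}<- : Sinf_fun h (Sinf_inv g k) = k by rewrite hk; exact: Sinf_invVK.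
exact: Sinf_invK.
Qed.

HB.instance Definition _ := Group_isTopGroup.Build Sinf
  Sinf_mulg_continuous Sinf_invg_continuous.

Record language := Language {
  fsym : countType ; farity : fsym -> nat ;
  rsym : countType ; rarity : rsym -> nat
}.

Record structure (L : language) (A : Type) := Structure {
  fint : forall f : fsym L, (farity f).-tuple A -> A ;
  rint : forall r : rsym L, (rarity r).-tuple A -> Prop
}.

Definition isomorphism (L : language) (A B : Type) (g : A -> B)
    (M : structure L A) (N : structure L B) : Prop :=
  [/\ bijective g,
      forall f a, g (@fint L A M f a) = @fint L B N f (map_tuple g a) &
      forall r a, @rint L A M r a <-> @rint L B N r (map_tuple g a)].

(* Substructures are allowed to be empty. *)
Definition closed_under (L : language) (A : Type) (M : structure L A)
    (S : set A) : Prop :=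
  forall (f : fsym L) a, (forall i, S (tnth a i)) -> S (@fint L A M f a).

Definition generated (L : language) (A : Type) (M : structure L A)
    (B : set A) : set A := smallest (closed_under M) B.

(* Closure under isomorphism is what makes Mod_omega below an invariant subset
   of XL, on which S_oo acts. *)
Record structure_class (L : language) := StructureClass {
  in_class :> forall A : Type, structure L A -> Prop ;
  class_iso : forall (A B : Type) (g : A -> B) M N,
    isomorphism g M N -> in_class M -> in_class N
}.

Section iso.
Context {L : language} {A B : Type} (g : A -> B) (M : structure L A)
  (N : structure L B) (gMN : isomorphism g M N).

Lemma map_tupleK n (h : B -> A) : cancel g h ->
  cancel (@map_tuple n _ _ g) (map_tuple h).
Proof.
by move=> gK a; apply: val_inj; exact: mapK.
Qed.

Lemma iso_inv : exists2 h : B -> A, isomorphism h N M & cancel g h /\ cancel h g.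
Proof.
have [[h gK hK] gf gr] := gMN; exists h => //; split; first by exists g.
- move=> f b; apply: (can_inj gK); rewrite gf hK; congr fint.
  by apply: val_inj; rewrite /= mapK.
- move=> r b; rewrite gr; suff -> : map_tuple g (map_tuple h b) = b by [].
  by apply: val_inj; rewrite /= mapK.
Qed.

Lemma iso_closed_under (S : set B) : closed_under N S ->
  closed_under M (g @^-1` S).
Proof.
have [_ gf _] := gMN.
move=> NS f a aS; rewrite /preimage/= gf; apply: NS => i.
by rewrite tnth_map; exact: aS.
Qed.

Lemma iso_generated (X : set A) (x : A) : generated M X x ->
  generated N (g @` X) (g x).
Proof.
move=> Mx S [NS XS]; apply: (Mx (g @^-1` S)); split.
  exact: iso_closed_under.
by move=> y Xy; apply: XS; exists y.
Qed.

End iso.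

Definition XL (L : language) : Type := structure L nat.
HB.instance Definition _ L := gen_eqMixin (XL L).
HB.instance Definition _ L := gen_choiceMixin (XL L).

Definition XL_subbasis (L : language) : set (set (XL L)) :=
  [set U | (exists r a, U = [set M : XL L | @rint L nat M r a]) \/
           (exists r a, U = [set M : XL L | ~ @rint L nat M r a]) \/
           (exists f a b, U = [set M : XL L | @fint L nat M f a = b])].

HB.instance Definition _ L :=
  isSubBaseTopological.Build (XL L) (@XL_subbasis L) id.

Lemma XL_cvg L (F : set_system (XL L)) (FF : Filter F) (M : XL L) :
  (forall U, XL_subbasis U -> U M -> F U) -> F --> M.
Proof.
move=> FU A; rewrite /= (@nbhsE (XL L)).
move=> [_ [[B sB <-] [C BC CM] sUBA]].
rewrite nbhs_filterE; apply: filterS sUBA _; apply: (@filterS _ _ _ C).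
  by move=> ? ?; exists C.
have /sB [D sD IDeC] := BC; rewrite -IDeC; apply: filter_bigI => E DE.
have /sD := DE; rewrite inE => SE; apply: FU => //.
by move: CM; rewrite -IDeC; apply.
Qed.

Lemma XL_subbasis_nbhs L (U : set (XL L)) (M : XL L) :
  XL_subbasis U -> U M -> nbhs M U.
Proof.
move=> SU UM; apply: open_nbhs_nbhs; split => //.
exists [set U]; last by rewrite bigcup_set1.
move=> _ ->; exists [fset U]%fset.
  by move=> V /fset1P ->; exact: mem_set.
by rewrite set_fset1 bigcap_set1.
Qed.

Section logic_action.
Context {L : language}.

Definition logic_act (g : Sinf) (M : XL L) : XL L :=
  Structure
    (fun f a => g (@fint L nat M f (map_tuple (Sinf_inv g) a)))
    (fun r a => @rint L nat M r (map_tuple (Sinf_inv g) a)).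

Lemma map_tuple_Sinf_invK n (g : Sinf) :
  cancel (@map_tuple n _ _ g) (map_tuple (Sinf_inv g)).
Proof. exact/map_tupleK/Sinf_invK. Qed.

Lemma map_tuple_Sinf_invVK n (g : Sinf) :
  cancel (@map_tuple n _ _ (Sinf_inv g)) (map_tuple g).
Proof. exact/map_tupleK/Sinf_invVK. Qed.

Lemma structure_eq (A : Type) (M N : structure L A) :
  (forall f a, @fint L A M f a = @fint L A N f a) ->
  (forall r a, @rint L A M r a <-> @rint L A N r a) -> M = N.
Proof.
case: M N => fM rM [fN rN] /= fE rE; congr Structure.
  by apply: functional_extensionality_dep => f; apply/funext => a.
apply: functional_extensionality_dep => r; apply/funext => a.
exact/propext.
Qed.

(* The action is the one determined by: g M = N iff g is an isomorphism. *)
Lemma logic_actP (g : Sinf) (M N : XL L) :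
  logic_act g M = N <-> isomorphism g M N.
Proof.
split=> [<-|[_ gf gr]].
- split; first exact: Sinf_bij.
  + by move=> f a /=; rewrite map_tuple_Sinf_invK.
  + by move=> r a /=; rewrite map_tuple_Sinf_invK.
- apply: structure_eq => [f a|r a] /=.
  + by rewrite gf map_tuple_Sinf_invVK.
  + by rewrite gr map_tuple_Sinf_invVK.
Qed.

Lemma logic_act1 (M : XL L) : logic_act 1%g M = M.
Proof.
apply/logic_actP; split; first exact: Sinf_bij.
- by move=> f a; congr fint; apply: val_inj; rewrite /= map_id.
- by move=> r a; suff -> : map_tuple (1%g : Sinf) a = a by [];
    apply: val_inj; rewrite /= map_id.
Qed.

Lemma logic_actM (g h : Sinf) (M : XL L) :
  logic_act (g * h)%g M = logic_act g (logic_act h M).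
Proof.
have mapM n (a : n.-tuple nat) :
    map_tuple ((g * h)%g : Sinf) a = map_tuple g (map_tuple h a).
  by apply: val_inj; rewrite /= -map_comp.
apply/logic_actP; split; first exact: Sinf_bij.
- by move=> f a; rewrite mapM /= !map_tuple_Sinf_invK.
- by move=> r a; rewrite mapM /= !map_tuple_Sinf_invK.
Qed.

Lemma Sinf_inv_near_tuple (g : Sinf) n (a : n.-tuple nat) :
  nbhs g [set h : Sinf | map_tuple (Sinf_inv h) a = map_tuple (Sinf_inv g) a].
Proof.
suff H i : nbhs g [set h : Sinf |
    Sinf_inv h (tnth a i) = Sinf_inv g (tnth a i)].
  have HI : nbhs g (\bigcap_(i in [set` fset_set [set: 'I_n]])
      [set h : Sinf | Sinf_inv h (tnth a i) = Sinf_inv g (tnth a i)]).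
    by apply: filter_bigI => i _; exact: H.
  apply: filterS HI => h hg.
  apply: eq_from_tnth => i; rewrite !tnth_map; apply: hg.
  by rewrite /= in_fset_set; [exact: mem_set|exact: finite_finset].
exact: (@Sinf_invg_continuous g _ (Sinf_near (g^-1)%g (tnth a i))).
Qed.

Lemma logic_act_continuous :
  continuous (fun p : Sinf * XL L => logic_act p.1 p.2).
Proof.
move=> [g M]; apply: XL_cvg => U.
have near_pair (P : set Sinf) (Q : set (XL L)) :
    nbhs g P -> nbhs M Q -> nbhs ((g, M) : Sinf * XL L) (P `*` Q).
  by move=> gP MQ; exists (P, Q).
move=> [[r [a ->]]|[[r [a ->]]|[f [a [b ->]]]]] /= UM.
- pose Q := [set N : XL L | @rint L nat N r (map_tuple (Sinf_inv g) a)].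
  have MQ : nbhs M Q by apply: XL_subbasis_nbhs => //; left; do 2 eexists.
  apply: filterS (near_pair _ _ (Sinf_inv_near_tuple g a) MQ) => -[h N].
  by move=> [/= ha NQ]; rewrite ha.
- pose Q := [set N : XL L | ~ @rint L nat N r (map_tuple (Sinf_inv g) a)].
  have MQ : nbhs M Q by apply: XL_subbasis_nbhs => //; right; left; do 2 eexists.
  apply: filterS (near_pair _ _ (Sinf_inv_near_tuple g a) MQ) => -[h N].
  by move=> [/= ha NQ]; rewrite ha.
- pose c := @fint L nat M f (map_tuple (Sinf_inv g) a).
  pose Q := [set N : XL L | @fint L nat N f (map_tuple (Sinf_inv g) a) = c].
  have MQ : nbhs M Q.
    by apply: XL_subbasis_nbhs => //; right; right; do 3 eexists.
  have gP := filterI (Sinf_inv_near_tuple g a) (Sinf_near g c).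
  have gPQ := near_pair _ _ (gP (nbhs_filter g)) MQ.
  apply: filterS gPQ => -[h N] [/= [ha hc] NQ].
  by rewrite ha NQ hc.
Qed.

Variable K : structure_class L.

Definition Mod_set : set (XL L) := [set M | K nat M].

Lemma Mod_act_subproof (g : Sinf) (M : Mod_set) :
  logic_act g (\val M) \in Mod_set.
Proof.
apply/mem_set; apply: (class_iso _ (set_mem (valP M))).
exact/logic_actP.
Qed.

Definition Mod_act (g : Sinf) (M : Mod_set) : Mod_set :=
  exist _ (logic_act g (\val M)) (Mod_act_subproof g M).

Lemma Mod_act1 (M : Mod_set) : Mod_act 1%g M = M.
Proof. by apply: val_inj; exact: logic_act1. Qed.

Lemma Mod_actM (g h : Sinf) (M : Mod_set) :
  Mod_act (g * h)%g M = Mod_act g (Mod_act h M).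
Proof. by apply: val_inj; exact: logic_actM. Qed.

Lemma Mod_act_continuous :
  continuous (fun p : Sinf * Mod_set => Mod_act p.1 p.2).
Proof.
move=> [g M] U [V [[W oW <-] WgM] VU].
have valc : {for M, continuous (\val : Mod_set -> XL L)}.
  exact: initial_continuous.
have nW : nbhs (logic_act g (\val M)) W by exact: open_nbhs_nbhs.
have [[P Q] [/= gP MQ] PQW] := @logic_act_continuous (g, \val M) W nW.
exists (P, \val @^-1` Q); first by split => //; exact: valc.
by move=> [h N] [/= Ph QN]; apply: VU; exact: (PQW (h, \val N)).
Qed.

(* The carrier has the subspace topology, so meagerness and the Baire property
   are relative to Mod_set. *)
Definition Mod_omega : gspace Sinf :=
  GSpace Mod_act1 Mod_actM Mod_act_continuous.

End logic_action.

Definition hat_lang (L : language) : language := {|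
  fsym := fsym L ; farity := @farity L ;
  rsym := (rsym L + nat)%type ;
  rarity := fun r => match r with inl r => rarity r | inr _ => 1 end
|}.

Definition reduct (L : language) (A : Type) (M : structure (hat_lang L) A) :
    structure L A :=
  @Structure L A (fun f => @fint (hat_lang L) A M f)
    (fun r => @rint (hat_lang L) A M (inl r)).

Definition label (L : language) (A : Type) (M : structure (hat_lang L) A)
    (i : nat) (a : A) : Prop :=
  @rint (hat_lang L) A M (inr i) [tuple a].

Definition is_labeled (L : language) (K : structure_class L) (A : Type)
    (M : structure (hat_lang L) A) : Prop :=
  K A (reduct M) /\
  forall a b, (forall i, label M i a <-> label M i b) -> a = b.

Lemma is_labeled_iso (L : language) (K : structure_class L)
    (A B : Type) (g : A -> B) M N :
  isomorphism g M N -> is_labeled K M -> is_labeled K N.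
Proof.
move=> gMN [KM lab]; have [gb gf gr] := gMN; split.
  by apply: (class_iso _ KM (g := g)); split => // r a; exact: (gr (inl r)).
have [h gK hK] := gb; move=> a b ab.
apply: (can_inj hK).
have labE x i : label M i (h x) <-> label N i x.
  rewrite /label gr; suff -> : map_tuple g [tuple h x] = [tuple x] by [].
  by apply: val_inj; rewrite /= hK.
by apply: lab => i; rewrite !labE.
Qed.

Definition labeled (L : language) (K : structure_class L) :
    structure_class (hat_lang L) :=
  StructureClass (@is_labeled_iso L K).

Definition bkl_lang (n : nat) : language := {|
  fsym := nat ; farity := fun=> n ; rsym := nat ; rarity := fun=> n
|}.

Definition bkl_s (n : nat) (A : Type) (M : structure (bkl_lang n) A) (i : nat)
  (a : n.-tuple A) : A := @fint (bkl_lang n) A M i a.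
Definition bkl_R (n : nat) (A : Type) (M : structure (bkl_lang n) A) (j : nat)
  (a : n.-tuple A) : Prop := @rint (bkl_lang n) A M j a.

(* B1: some of the blocks R_j of the partition may be empty. B2: k ranges over
   the index 0 of the n-tuple a. *)
Record is_BKL (n : nat) (A : Type) (M : structure (bkl_lang n) A) : Prop := {
  bkl_B1 : forall a, exists! j, bkl_R M j a ;
  bkl_B2 : forall j a, bkl_R M j a -> forall i, j < i ->
    forall k : 'I_n, k = 0 :> nat -> bkl_s M i a = tnth a k ;
  bkl_B3 : forall B : set A, (B #= `I_n.+1)%card ->
    exists2 b, B b & generated M (B `\ b) b ;
  bkl_B4 : forall B : set A, finite_set B -> finite_set (generated M B)
}.

Lemma is_BKL_iso (n : nat) (A B : Type) (g : A -> B)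
    (M : structure (bkl_lang n) A) N :
  isomorphism g M N -> is_BKL M -> is_BKL N.
Proof.
move=> gMN [B1 B2 B3 B4].
have [h hNM [gK hK]] := iso_inv gMN.
have [_ gf gr] := gMN; have [_ hf hr] := hNM.
have mapK (b : n.-tuple B) : map_tuple g (map_tuple h b) = b.
  by apply: val_inj; rewrite /= mapK.
have imK (S : set B) : g @` (h @` S) = S.
  by apply/seteqP; split => [_ [_ [y Sy <-] <-]|y Sy];
    [rewrite hK|exists (h y); [exists y|rewrite hK]].
split.
- move=> b; have [j [Rj uj]] := B1 (map_tuple h b); exists j; split.
    exact/(hr j).
  by move=> i Ri; apply: uj; exact/(hr i).
- move=> j b Rj i ji k k0.
  have := B2 j (map_tuple h b) (proj1 (hr j b) Rj) i ji k k0.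
  by rewrite tnth_map => /(congr1 g); rewrite hK => <-; rewrite /bkl_s gf mapK.
- move=> S Sn; have hSn : (h @` S #= `I_n.+1)%card.
    by apply: card_eq_trans Sn; apply: inj_card_eq; apply: in2W; exact: can_inj hK.
  have [a [y Sy <-] ay] := B3 _ hSn; exists y => //.
  have := iso_generated gMN ay; rewrite hK.
  suff -> : g @` ((h @` S) `\ h y) = S `\ y by [].
  apply/seteqP; split => [_ [_ [[z Sz <-] zy] <-]|z [Sz zy]].
    by rewrite hK; split => // zy'; apply: zy; rewrite /= zy'.
  exists (h z); last by rewrite hK.
  by split; [exists z|move=> /= /(can_inj hK)].
- move=> S Sfin; have := B4 _ (finite_image h Sfin).
  move=> /(finite_image g); apply: sub_finite_set => y Sy.
  exists (h y); last by rewrite hK.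
  exact: (iso_generated hNM Sy).
Qed.

Definition BKL (n : nat) : structure_class (bkl_lang n) :=
  StructureClass (@is_BKL_iso n).

(* Main.v *)
(* Labels make embeddings unique, and a structure x right-embeds in x' exactly
   when it embeds in x' as a model: if (g_i) is right-Cauchy and g_i x' -> x,
   then the inverses of the g_i converge pointwise to an embedding. So a copy of
   the m-cube amounts to substructures A_s, s a subset of {0, ..., m-1}, of one
   structure, with A_s contained in A_t iff s is contained in t.

   Upper bound.  If the n-cube embeds, pick for i < n an element b_i of A_{i}
   outside A_{complement of i}, and an element b_n of the infinite A_{empty}
   outside the finite substructure generated by the b_i.  No element of
   {b_0, ..., b_n} is generated by the others, against (B3).

   Lower bound.  Let U be open nonempty and F_i nowhere dense.  A finite
   structure A whose elements carry subsets of {0, ..., n-2} as supports, with the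
   support of a value of an operation contained in the union of the supports of
   its arguments, gives finite structures A_s = {x | supp x <= s}, each provided
   with an injection into nat that plays the role of a basic open set.
   Repeatedly extend some A_s into the complement of some F_i.  The new elements
   get support s, and A is amalgamated with the extension by letting each tuple
   that lies in neither part enumerate all elements whose support is contained
   in its own.  (B3) survives, because the union of the supports of a set of
   n+1 elements that lies in neither part is reached by one of its new elements,
   which covers s, and at most n-1 further ones.  In the limit each A_s is
   isomorphic to a structure in U outside all F_i, and they form an (n-1)-cube.
   This also shows that the space is not meager in itself. *)

Require Import Defs.
From mathcomp Require Import finmap boolp classical_sets cardinality.
From mathcomp Require Import reals topology.
From mathcomp Require Import all_boot all_order all_algebra zify.
Set Implicit Arguments.
Unset Strict Implicit.
Unset Printing Implicit Defensive.
Import Order.TTheory GRing.Theory Num.Theory.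

(** * Prestructures *)

Section Prestructures.
Context (n : nat).
Implicit Types (a : n.-tuple nat) (b l : seq nat) (x y : nat).

(* A labeled structure on nat in which (B1) is built in: [rk P a] is the index
   of the relation satisfied by [a]. *)
Record pre := Pre {
  op : nat -> n.-tuple nat -> nat ;
  rk : n.-tuple nat -> nat ;
  lb : nat -> nat -> bool
}.
Implicit Types P Q S : pre.

Definition op_closed P (D : nat -> Prop) :=
  forall i a, {in a, forall x, D x} -> D (op P i a).

Definition gen P (B : nat -> Prop) x :=
  forall D, op_closed P D -> (forall y, B y -> D y) -> D x.

Definition dep P b := exists2 x, x \in b & gen P (fun y => y \in b /\ y != x) x.

Definition B2_at P a := forall i, rk P a < i -> op P i a = head 0 a.

Definition B3_at P b := uniq b -> size b = n.+1 -> dep P b.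

(** For finite [D] this serves as a basic open condition on [Q]: the part [D] of [P] is carried into
    [Q] by [g], and only labels below [N] are prescribed. Injectivity of [g] is supplied
    separately. *)
Definition agree (D : pred nat) (N : nat) (g : nat -> nat) P Q :=
  [/\ forall i a, all D a -> op Q i (map_tuple g a) = g (op P i a),
      forall a, all D a -> rk Q (map_tuple g a) = rk P a &
      forall x i, D x -> i < N -> lb Q (g x) i = lb P x i].

(** A closed set [E] of [Q] pulls back to the set of [y] in [D] with [g y] in [E], which is closed
    in [P]. *)
Lemma gen_image P Q (D : nat -> Prop) g B x : op_closed P D ->
  (forall i a, {in a, forall x, D x} ->
     op Q i (map_tuple g a) = g (op P i a)) ->
  (forall y, B y -> D y) ->
  gen P B x -> gen Q (fun z => exists2 y, B y & z = g y) (g x).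
Proof.
move=> cD gPQ BD Bx E cE BE.
suff [] : D x /\ E (g x) by [].
apply: (Bx (fun y => D y /\ E (g y))) => [i a aD|y By].
  split; first by apply: cD => y /aD [].
  rewrite -gPQ; last by move=> y /aD [].
  by apply: cE => z /mapP [y /aD [_ Ey] ->].
by split; [exact: BD|apply: BE; exists y].
Qed.

(** The image under [g] of the intersection of [D] with a closed set [E] of [P] is closed in [Q];
    injectivity of [g] on [D] then recovers [x] itself. *)
Lemma gen_preimage P Q (D : nat -> Prop) g B x : op_closed P D ->
  (forall i a, {in a, forall x, D x} ->
     op Q i (map_tuple g a) = g (op P i a)) ->
  (forall x y, D x -> D y -> g x = g y -> x = y) ->
  (forall y, B y -> D y) -> D x ->
  gen Q (fun z => exists2 y, B y & z = g y) (g x) -> gen P B x.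
Proof.
move=> cD gPQ ginj BD Dx Bx E cE BE.
suff [y [Dy Ey] /ginj] : exists2 y, D y /\ E y & g x = g y by move=> ->.
apply: (Bx (fun z => exists2 y, D y /\ E y & z = g y)) => [i a aD|_ [y By ->]].
  pose h z := xget 0 [set y | (D y /\ E y) /\ z = g y].
  have hP z : z \in a -> (D (h z) /\ E (h z)) /\ z = g (h z).
    by move=> /aD [y yDE zy]; apply: (@xgetPex _ 0 [set y | (D y /\ E y) /\ z = g y]);
      exists y.
  have aE : a = map_tuple g (map_tuple h a).
    apply: val_inj; rewrite /= -map_comp -[LHS]map_id.
    by apply/eq_in_map => z /hP [].
  have hD : {in map_tuple h a, forall x, D x} by move=> _ /mapP [z /hP [[? _] _] ->].
  exists (op P i (map_tuple h a)); last by rewrite -gPQ // -aE.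
  split; first exact: cD.
  by apply: cE => _ /mapP [z /hP [[_ ?] _] ->].
by exists y => //; split; [exact: BD|exact: BE].
Qed.

Lemma gen_sub P (B B' : nat -> Prop) x :
  (forall y, B y -> B' y) -> gen P B x -> gen P B' x.
Proof. by move=> BB' Bx D cD B'D; apply: Bx => // y /BB' /B'D. Qed.

(** The tool by which (B3) passes between a structure and its embedded copies. *)
Lemma dep_image P Q (D : nat -> Prop) g b : op_closed P D ->
  (forall i a, {in a, forall x, D x} ->
     op Q i (map_tuple g a) = g (op P i a)) ->
  (forall x y, D x -> D y -> g x = g y -> x = y) ->
  {in b, forall x, D x} -> dep P b <-> dep Q (map g b).
Proof.
move=> cD gPQ ginj bD; split => [[x xb bx]|[_ /mapP [x xb ->] bx]].
  exists (g x); first exact: map_f.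
  apply: gen_sub (gen_image cD gPQ _ bx) => [_ [y [yb yx] ->]|y [/bD]//].
  split; first exact: map_f.
  by apply: contra yx => /eqP /ginj -> //; exact: bD.
exists x => //.
apply: (gen_preimage cD gPQ ginj) => [y [/bD]//||]; first exact: bD.
apply: gen_sub bx => _ [/mapP [y yb ->] gyx]; exists y => //; split=> //.
by apply: contraNneq gyx => ->.
Qed.

(* An [n]-tuple cannot exhaust [n.+1] elements, so if it generates all of [b],
   then some element of [b] is generated by the others. *)
Lemma dep_tuple P b a : uniq b -> size b = n.+1 -> {subset a <= b} ->
  {in b, forall x, exists i, op P i a = x} -> dep P b.
Proof.
move=> ub sb ab oa.
have /allPn [x xb xa] : ~~ all (mem a) b.
  apply/negP => /allP /(uniq_leq_size ub); rewrite sb size_tuple; lia.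
exists x => // D cD BD; have [i <-] := oa x xb.
by apply: cD => y ya; apply: BD; split; [exact: ab|apply: contraNneq xa => <-].
Qed.

Definition to_struct P : structure (hat_lang (bkl_lang n)) nat :=
  @Structure (hat_lang (bkl_lang n)) nat (fun i a => op P i a)
    (fun r => match r return (@rarity (hat_lang (bkl_lang n)) r).-tuple nat -> Prop
       with inl j => fun t => rk P t = j | inr i => fun t => lb P (tnth t ord0) i end).

(** Labeled BKL structures on nat, with lists in place of finite sets. The closed list [d] in the
    local finiteness clause bounds the substructure generated by [l]. *)
Record good P : Prop := {
  goodB2 : forall a, B2_at P a ;
  goodB3 : forall b, B3_at P b ;
  goodB4 : forall l, exists2 d : seq nat, {subset l <= d} & op_closed P (fun x => x \in d) ;
  good_lb : forall x y, (forall i, lb P x i = lb P y i) -> x = y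
}.

Lemma generatedE P (B : set nat) x :
  generated (reduct (to_struct P)) B x <-> gen P B x.
Proof.
have cE D : closed_under (reduct (to_struct P)) D <-> op_closed P D.
  split=> cD i a aD.
    by apply: cD => k; apply: aD; exact: mem_tnth.
  by apply: cD => _ /tnthP [k ->]; exact: aD.
split=> [Bx D cD BD|Bx D [cD BD]].
  by apply: Bx; split => //; apply (proj2 (cE D)).
by apply: (Bx D) => //; apply (proj1 (cE D)).
Qed.

Lemma card_set_seq (B : set nat) k : (B #= `I_k)%card ->
  exists b, [/\ uniq b, size b = k & B = [set` b]%classic].
Proof.
move=> Bk; have /finite_fsetP [F FE] : finite_set B by apply/finite_setP; exists k.
exists (enum_fset F); split => //; first exact: fset_uniq.
apply/card_eq_fsetP. rewrite -FE. exact: Bk.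
Qed.

Lemma goodP P : 0 < n -> is_labeled (BKL n) (to_struct P) <-> good P.
Proof.
move=> n0; have hd a (k : 'I_n) : k = 0 :> nat -> tnth a k = head 0 a.
  by move=> k0; rewrite (tnth_nth 0) k0 nth0.
split=> [[[B1 B2 B3 B4] lP]|[B2 B3 B4 lP]].
  split.
  - by move=> a i ai; rewrite -(hd a (Ordinal n0)) // -(B2 _ a erefl i ai).
  - move=> b ub sb.
    have [] := B3 [set` b]%classic.
      have -> : [set` b]%classic = [set` [fset x in b]%fset]%classic.
        by apply/seteqP; split=> x /=; rewrite finmap.inE.
      by apply/card_eq_fsetP; rewrite card_fseq undup_id.
    move=> x xb /generatedE bx; exists x => //.
    by apply: gen_sub bx => y [/= yb /eqP yx].
  - move=> l; have /finite_seqP [d dE] := B4 [set` l]%classic (finite_seq l).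
    exists d; first by move=> x xl; have : [set` d]%classic x by rewrite -dE => D [_]; apply.
    move=> i a aD; suff : [set` d]%classic (op P i a) by [].
    rewrite -dE; apply/generatedE => D cD lD; apply: (cD) => x /aD xd.
    have : [set` d]%classic x by []. by rewrite -dE => /generatedE /(_ D cD lD).
  - move=> x y xy; apply: lP => i.
    by rewrite /label /= !(tnth_nth 0) /= xy.
split; last first.
  move=> x y xy; apply: lP => i.
  by have := xy i; rewrite /label /= !(tnth_nth 0) /= => xyi; apply/idP/idP; apply xyi.
split.
- by move=> a; exists (rk P a).
- move=> j a <- i ai k k0; rewrite hd //; exact: B2.
- move=> _ /card_set_seq [b [ub sb ->]]; have [x xb bx] := B3 b ub sb.
  by exists x => //; apply/generatedE; apply: gen_sub bx => y [? /eqP ?].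
- move=> _ /finite_seqP [l ->]; have [d ld cd] := B4 l.
  apply: (sub_finite_set _ (finite_seq d)) => x /generatedE; apply=> //.
Qed.

Definition of_struct (M : structure (hat_lang (bkl_lang n)) nat)
    (H : is_labeled (BKL n) M) : pre :=
  @Pre (fun i a => bkl_s (reduct M) i a)
     (fun a => projT1 (cid (bkl_B1 (proj1 H) a)))
     (fun x i => `[< label M i x >]).

Lemma of_structK M (H : is_labeled (BKL n) M) : to_struct (of_struct H) = M.
Proof.
apply: structure_eq => // -[j|i] a /=.
  case: cid => k [Rk uk] /=; split=> [<- //|]; exact: uk.
rewrite asboolE /label; suff -> : a = [tuple tnth a ord0] by [].
by apply: eq_from_tnth => k; rewrite (ord1 k).
Qed.

End Prestructures.

(** * Finite partial structures *)

Section ListInverse.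
Context (l : seq nat) (g : nat -> nat).

(** Off the image of [l] this takes the default value 0. *)
Definition list_inv y := nth 0 l (index y (map g l)).

Lemma list_inv_mem y : y \in map g l -> list_inv y \in l.
Proof. by move=> yl; rewrite mem_nth // -(size_map g) index_mem. Qed.

Lemma list_invK y : y \in map g l -> g (list_inv y) = y.
Proof.
move=> yl; rewrite -(nth_map 0 0 g) ?nth_index //.
by rewrite -(size_map g) index_mem.
Qed.

Lemma list_invVK x : {in l &, injective g} -> x \in l -> list_inv (g x) = x.
Proof.
move=> gi xl; apply: gi => //; last by rewrite list_invK ?map_f.
by rewrite list_inv_mem ?map_f.
Qed.

Lemma map_list_invK s : {subset s <= map g l} -> map g (map list_inv s) = s.
Proof.
move=> sl; rewrite -map_comp -[RHS]map_id; apply/eq_in_map => y /sl yl /=.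
exact: list_invK.
Qed.

Lemma map_list_invVK s : {in l &, injective g} -> {subset s <= l} ->
  map list_inv (map g s) = s.
Proof.
move=> gi sl; rewrite -map_comp -[RHS]map_id; apply/eq_in_map => y /sl yl /=.
exact: list_invVK.
Qed.

End ListInverse.

(** * Completing a finite part to a model on nat *)

Section FinitePart.
Context (m : nat).
Let n := m.+1.
Implicit Types (a : n.-tuple nat) (b l : seq nat) (P Q S : pre n).

Lemma head_mem a : head 0 a \in (a : seq nat).
Proof. by case: a => -[|x s] //= _; rewrite mem_head. Qed.

Lemma head_map_tuple (g : nat -> nat) a : head 0 (map_tuple g a) = g (head 0 a).
Proof. by case: a => -[]. Qed.

Record fin_bkl P (D : pred nat) : Prop := {
  fin_closed : op_closed P D ;
  finB2 : forall a, all D a -> B2_at P a ;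
  finB3 : forall b, all D b -> B3_at P b
}.

(* Each tuple meeting the complement of the given finite part enumerates an
   initial segment of nat containing that part and the tuple. *)
Lemma realize S (D : pred nat) K N g : fin_bkl S D -> (forall x, D x -> x < K) ->
  {in D &, injective g} -> exists2 Q, good Q & agree D N g S Q.
Proof.
move=> [cS S2 S3] DK gi.
pose l := [seq x <- iota 0 K | D x]; pose E := map g l; pose h := list_inv l g.
have lD x : (x \in l) = D x.
  by rewrite mem_filter mem_iota /= add0n; case Dx: (D x) => //=; rewrite DK.
have gil : {in l &, injective g} by move=> x y; rewrite !lD; exact: gi.
have hD x : x \in E -> D (h x) by rewrite -lD; exact: list_inv_mem.
pose B := \max_(y <- E) y.
pose top (a : seq nat) := maxn B (\max_(y <- a) y).
have topB (a : seq nat) y : y \in a -> y <= top a.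
  by move=> ya; rewrite leq_max; apply/orP; right; exact: leq_bigmax_seq.
have EB y : y \in E -> y <= B by move=> yE; exact: leq_bigmax_seq.
(* A tuple not contained in [E] lists 0, ..., [top a] and then returns its first entry, as (B2)
   demands at rank [top a]. Label [N + y] belongs to [y] alone, which separates all elements. *)
pose Q := @Pre n
  (fun i a => if all (mem E) a then g (op S i (map_tuple h a))
              else if i <= top a then i else head 0 a)
  (fun a => if all (mem E) a then rk S (map_tuple h a) else top a)
  (fun y i => if i < N then (y \in E) && lb S (h y) i else i == N + y).
have ED a : all D a -> all (mem E) (map_tuple g a).
  by move=> /allP aD; apply/allP => _ /mapP [x /aD Dx ->]; rewrite /= map_f // lD.
have hgD a : all D a -> map_tuple h (map_tuple g a) = a.
  move=> /allP aD; apply: val_inj; rewrite /= map_list_invVK // => x.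
  by rewrite lD; exact: aD.
have opD i a : all D a -> op Q i (map_tuple g a) = g (op S i a).
  by move=> aD; rewrite /= ED // hgD.
have rkD a : all D a -> rk Q (map_tuple g a) = rk S a.
  by move=> aD; rewrite /= ED // hgD.
have EgD a : all (mem E) a -> exists2 a' : n.-tuple nat, all D a' & a = map_tuple g a'.
  move=> /allP aE; exists (map_tuple h a).
    by apply/allP => _ /mapP [x /aE xE ->]; exact: hD.
  by apply: val_inj; rewrite /= map_list_invK.
exists Q; last first.
  split=> // x i Dx iN /=; rewrite iN map_f ?lD //= /h list_invVK ?lD //.
split.
- move=> a; rewrite /B2_at; have [/EgD [a' Da' ->]|nE] := boolP (all (mem E) a).
    by move=> i; rewrite rkD // opD // head_map_tuple => /S2 ->.
  by move=> i /=; rewrite (negbTE nE) => /ltn_geF ->.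
- move=> b ub sb; have [bE|nE] := boolP (all (mem E) b).
    have -> : b = map g (map h b) by rewrite map_list_invK //; exact/allP.
    apply/(dep_image (D := D) (P := S)) => //.
    + by move=> i a /allP; exact: opD.
    + by move=> _ /mapP [x /(allP bE) xE ->]; exact: hD.
    apply: S3; rewrite ?size_map //.
      by apply/allP => _ /mapP [x /(allP bE) xE ->]; exact: hD.
    rewrite map_inj_in_uniq // => x y /(allP bE) xE /(allP bE) yE /(congr1 g).
    by rewrite !list_invK.
  (* The constant tuple at the largest element of [b] outside [E] already enumerates all of [b],
     since [top] also dominates [E]. *)
  pose x := \max_(y <- b | y \notin E) y.
  have /allPn [z zb zE] := nE.
  have [xb xE] : x \in b /\ x \notin E.
    rewrite /x -big_filter; set b' := [seq _ <- _ | _].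
    have : b' != [::] by rewrite -has_filter; apply/hasP; exists z.
    have : {subset b' <= [pred x | (x \in b) && (x \notin E)]}.
      by move=> y; rewrite mem_filter inE andbC.
    elim: b' => // y [|w t] IH sub _.
      by have := sub y; rewrite big_seq1 !inE eqxx /= => /(_ isT)/andP.
    rewrite big_cons; case: leqP => _.
      by apply: IH => // v vt; apply: sub; rewrite inE vt orbT.
    by apply/andP; apply: (sub y); rewrite mem_head.
  have xa : x \in nseq_tuple n x by rewrite mem_nseq eqxx.
  apply: (dep_tuple (a := nseq_tuple n x)) => //.
    by move=> y; rewrite mem_nseq => /andP [_ /eqP ->].
  move=> y yb; exists y; rewrite /Q /op; rewrite ifF; last first.
    by apply/negbTE/allPn; exists x.
  rewrite ifT //; have [/EB yB|yE] := boolP (y \in E).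
    by apply: leq_trans yB _; rewrite leq_maxl.
  apply: leq_trans (topB _ _ xa).
  by apply: (@leq_bigmax_seq _ b (fun y => y \notin E) id).
(* An initial segment of nat containing [E] is closed. *)
- move=> l'; exists (iota 0 (top l').+1) => [x xl|i a aD].
    by rewrite mem_iota ltnS topB.
  have hd : head 0 a < (top l').+1 by have := aD _ (head_mem a); rewrite mem_iota.
  rewrite mem_iota /=; case: ifP => [aE|_].
    rewrite add0n ltnS; apply: leq_trans (leq_maxl _ _); apply: EB.
    rewrite map_f // lD; apply: cS => _ /mapP [x xa ->]; apply: hD.
    exact: (allP aE).
  case: ifP => // /leq_ltn_trans; apply; rewrite add0n ltnS /top geq_max leq_maxl /=.
  by apply/bigmax_leqP_seq => y /aD; rewrite mem_iota.
- move=> x y /(_ (N + x)) /=; rewrite ltnNge leq_addr /= eqxx => /esym /eqP.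
  lia.
Qed.

End FinitePart.

(** * Amalgamation of supported structures *)

Section States.
Context (m : nat).
Let n := m.+1.
Implicit Types (a : n.-tuple nat) (b l : seq nat) (P Q S : pre n) (s : {set 'I_m}).

(* [str] matters only on the elements below [top], with labels known up to
   [depth]; the injections [emb s] are defined on the elements of support
   contained in [s]. *)
Record state := State {
  str : pre n ;
  top : nat ;
  depth : nat ;
  supp : nat -> {set 'I_m} ;
  emb : {set 'I_m} -> nat -> nat
}.
Implicit Types (st : state) (f : nat -> {set 'I_m}).

Definition usupp (f : nat -> {set 'I_m}) (b : seq nat) := \bigcup_(x <- b) f x.

Definition below st : pred nat := fun x => x < top st.

(** The finite structures [A_s] that grow into the vertices of the cube. *)
Definition dom st s : pred nat := fun x => (x < top st) && (supp st x \subset s).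

(** The labels below [depth] must already separate the elements below [top], so that separation
    persists in the limit. *)
Record valid st : Prop := {
  v_fin : fin_bkl (str st) (below st) ;
  v_supp : forall i a, all (below st) a ->
    supp st (op (str st) i a) \subset usupp (supp st) a ;
  v_lb : forall x y, below st x -> below st y ->
    (forall i, i < depth st -> lb (str st) x i = lb (str st) y i) -> x = y ;
  v_inj : forall s, {in dom st s &, injective (emb st s)}
}.

Record extends st st' : Prop := {
  ext_top : top st <= top st' ;
  ext_depth : depth st <= depth st' ;
  ext_op : forall i a, all (below st) a -> op (str st') i a = op (str st) i a ;
  ext_rk : forall a, all (below st) a -> rk (str st') a = rk (str st) a ;
  ext_lb : forall x i, below st x -> i < depth st -> lb (str st') x i = lb (str st) x i ;
  ext_supp : forall x, below st x -> supp st' x = supp st x ;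
  ext_emb : forall s x, below st x -> emb st' s x = emb st s x
}.

Lemma usuppP f b s : reflect {in b, forall x, f x \subset s} (usupp f b \subset s).
Proof.
rewrite /usupp; elim: b => [|x b IH]; first by rewrite big_nil sub0set; constructor.
rewrite big_cons subUset; apply: (iffP andP) => [[xs /IH bs] y|bs].
  by rewrite inE => /predU1P [->//|]; exact: bs.
split; first by apply: bs; rewrite mem_head.
by apply/IH => y yb; apply: bs; rewrite inE yb orbT.
Qed.

Lemma supp_usupp f b x : x \in b -> f x \subset usupp f b.
Proof. by move: x; exact/usuppP. Qed.

Lemma eq_in_usupp f g b : {in b, f =1 g} -> usupp f b = usupp g b.
Proof. by move=> fg; apply: eq_big_seq. Qed.

(** The support condition on operations makes [dom st s] closed; (B2) and (B3) are inherited from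
    the elements below [top]. *)
Lemma fin_dom st s : valid st -> fin_bkl (str st) (dom st s).
Proof.
move=> [[cS S2 S3] sS _ _].
have db : subpred (dom st s) (below st) by move=> x /andP [].
split.
- move=> i a aD; apply/andP; split.
    by apply: cS => x /aD /db.
  apply: subset_trans (sS i a _) _; first by apply/allP => x /aD /db.
  by apply/usuppP => x /aD /andP [].
- by move=> a /(sub_all db); exact: S2.
- by move=> b /(sub_all db); exact: S3.
Qed.

(* One element [y] of support [s] and one witness for each element of the union
   of the supports outside [s] make up at most [n] elements. *)
Lemma mixed_tuple f s b y : y \in b -> f y = s -> exists a,
  [/\ y \in (a : seq nat), {subset a <= b} & usupp f b \subset usupp f a].
Proof.
move=> yb fy; pose T := usupp f b.
(* The first element of [b] whose support contains [i], or [y] if there is none. *)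
pose c (i : 'I_m) := nth y b (find (fun x => i \in f x) b).
have cb i : c i \in b.
  rewrite /c; have [|] := ltnP (find (fun x => i \in f x) b) (size b).
    exact: mem_nth.
  by move=> ?; rewrite nth_default.
have ic i : i \in T -> i \in f (c i).
  move=> iT; rewrite /c; apply: (nth_find y (a := fun x => i \in f x)).
  apply: contraLR iT => /hasPn bi.
  apply: contraT; rewrite negbK => iT.
  suff /subsetP/(_ i iT) : T \subset ~: [set i] by rewrite !inE eqxx.
  apply/usuppP => x /bi xi; apply/subsetP => j jx; rewrite !inE.
  by apply: contraTneq jx => ->.
pose l := y :: [seq c i | i <- enum (T :\: s)].
have sl : size l <= n.
  rewrite /= size_map -cardE ltnS; apply: leq_trans (max_card _) _.
  by rewrite card_ord.
(* Padding with [y] brings the length to exactly [n]. *)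
have st : size (l ++ nseq (n - size l) y) == n by rewrite size_cat size_nseq subnKC.
have lb : {subset l <= b}.
  by move=> x; rewrite inE => /predU1P [->//|/mapP [i _ ->]].
exists (Tuple st); split.
- by rewrite /= mem_head.
- move=> x; rewrite mem_cat => /orP [/lb//|]; by rewrite mem_nseq => /andP [_ /eqP ->].
- apply/subsetP => i iT; have [is_|nis] := boolP (i \in s).
    have /subsetP : f y \subset usupp f (Tuple st) by apply: supp_usupp; rewrite /= mem_head.
    by apply; rewrite fy.
  have /subsetP : f (c i) \subset usupp f (Tuple st).
    apply: supp_usupp; rewrite mem_cat inE map_f ?orbT //.
    by rewrite mem_enum inE nis iT.
  by apply; exact: ic.
Qed.

(* Amalgamates [str st] with the extension of [dom st s] given by the finite
   substructure [E] of [M]. *)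
Lemma amalgam st s M (E : seq nat) N : valid st -> good M -> op_closed M (fun x => x \in E) ->
  (forall x, dom st s x -> emb st s x \in E) ->
  agree (dom st s) (depth st) (emb st s) (str st) M -> depth st <= N ->
  exists st', [/\ [/\ valid st', extends st st' & N <= depth st'],
     agree (dom st' s) N (emb st' s) (str st') M,
     forall x, dom st' s x -> emb st' s x \in E,
     forall y, y \in E -> exists2 x, dom st' s x & emb st' s x = y &
     forall x, top st <= x < top st' -> supp st' x = s].
Proof.
move=> vst gM cE domE [aop ark alb] sN.
have [[cS S2 S3] sS lbS injS] := vst.
have [M2 M3 _ _] := gM.
pose K := top st; pose As := [seq x <- iota 0 K | supp st x \subset s].
have AsD x : (x \in As) = dom st s x by rewrite mem_filter mem_iota andbC.
(* These are the elements of [E] not hit by [emb st s]; the numbers from [K] to [K' - 1] are added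
   to represent them. *)
pose E' := [seq y <- undup E | y \notin map (emb st s) As].
pose e := size E'; pose K' := K + e.
pose B := (\max_(t : {set 'I_m}) \max_(x < K) emb st t x).+1.
(* The injection for [s] sends new elements onto [E']. For any other [t] only injectivity matters,
   and [B + x] exceeds every old value. *)
pose g t x := if x < K then emb st t x else
  if t == s then nth 0 E' (x - K) else B + x.
pose sp x := if x < K then supp st x else s.
pose D' : pred nat := fun x => (x < K') && (sp x \subset s).
pose Ds := [seq x <- iota 0 K' | sp x \subset s].
have DsD x : (x \in Ds) = D' x by rewrite mem_filter mem_iota andbC.
have KK' : K <= K' by rewrite leq_addr.
have D'K x : x < K -> D' x = dom st s x.
  by move=> xK; rewrite /D' /dom /sp xK (leq_trans xK KK').
have D'new x : ~~ (x < K) -> D' x = (x < K').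
  by move=> xK; rewrite /D' /sp (negbTE xK) subxx andbT.
have gnew x : D' x -> ~~ (x < K) -> g s x \in E'.
  move=> /andP [xK' _] xK; rewrite /g (negbTE xK) eqxx mem_nth //.
  by move: xK xK'; rewrite /K' -/e; lia.
have gold x : D' x -> x < K -> g s x \in map (emb st s) As.
  by move=> Dx xK; rewrite /g xK map_f // AsD -D'K.
have E'new y : y \in E' -> y \notin map (emb st s) As.
  by rewrite mem_filter => /andP [].
have E'E y : y \in E' -> y \in E by rewrite mem_filter mem_undup => /andP [].
have gE x : D' x -> g s x \in E.
  move=> Dx; have [xK|xK] := boolP (x < K).
    by rewrite /g xK domE // -D'K.
  by apply: E'E; exact: gnew.
have Eg y : y \in E -> exists2 x, D' x & g s x = y.
  move=> yE; have [/mapP [x]|yA] := boolP (y \in map (emb st s) As).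
    rewrite AsD => Dx ->; have xK : x < K by case/andP: Dx.
    by exists x; [rewrite D'K|rewrite /g xK].
  have yE' : y \in E' by rewrite mem_filter yA mem_undup.
  have iK : ~~ (K + index y E' < K) by rewrite -leqNgt leq_addr.
  exists (K + index y E'); first by rewrite D'new // ltn_add2l index_mem.
  by rewrite /g (negbTE iK) eqxx addKn nth_index.
have gi : {in D' &, injective (g s)}.
  suff H x y : D' x -> D' y -> g s x = g s y -> x = y by move=> x y; exact: H.
  move=> Dx Dy.
  have [xK|xK] := boolP (x < K); have [yK|yK] := boolP (y < K).
  - by rewrite /g xK yK => /injS; apply; [move: Dx|move: Dy]; rewrite D'K.
  - by move=> gxy; have := E'new _ (gnew _ Dy yK); rewrite -gxy gold.
  - by move=> gxy; have := E'new _ (gnew _ Dx xK); rewrite gxy gold.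
  - move: Dx Dy; rewrite /g (negbTE xK) (negbTE yK) eqxx !D'new // => xK' yK' /eqP.
    rewrite nth_uniq ?filter_uniq ?undup_uniq -/e; lia.
have giDs : {in Ds &, injective (g s)} by move=> x y; rewrite !DsD; exact: gi.
pose h := list_inv Ds (g s).
have DsE y : y \in E -> y \in map (g s) Ds.
  by move=> /Eg [x Dx <-]; rewrite map_f // DsD.
have hD y : y \in E -> D' (h y) by move=> /DsE; rewrite -DsD; exact: list_inv_mem.
have hK y : y \in E -> g s (h y) = y by move=> /DsE; exact: list_invK.
have hVK x : D' x -> h (g s x) = x by rewrite -DsD; exact: list_invVK.
pose en a := [seq x <- iota 0 K' | sp x \subset usupp sp a].
(* On tuples lying in both parts the first two clauses coincide, because [M] agrees with [str st] on
   [dom st s]. A mixed tuple enumerates [en a] and then returns its first entry, in accordance with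
   (B2) at rank [size (en a)]. From [N] on, label [N + x] marks [x] alone. *)
pose S' := @Pre n
  (fun i a => if all (below st) a then op (str st) i a else
     if all D' a then h (op M i (map_tuple (g s) a)) else nth (head 0 a) (en a) i)
  (fun a => if all (below st) a then rk (str st) a else
     if all D' a then rk M (map_tuple (g s) a) else size (en a))
  (fun x i => if i < N then (if D' x then lb M (g s x) i else lb (str st) x i)
     else i == N + x).
(* Depth [N + K'] covers the separating labels [N + x] of all [x < K']. *)
pose st' := State S' K' (N + K') sp g.
have mapE a : all D' a -> {in map_tuple (g s) a, forall y, y \in E}.
  by move=> /allP aD _ /mapP [x /aD Dx ->]; exact: gE.
have gs_old x : x < K -> g s x = emb st s x by rewrite /g => ->.
have map_old a : all (below st) a -> map_tuple (g s) a = map_tuple (emb st s) a.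
  by move=> /allP ab; apply: val_inj; apply/eq_in_map => x /ab /gs_old.
have dom_old a : all (below st) a -> all D' a -> all (dom st s) a.
  by move=> /allP ab /allP aD; apply/allP => x xa; rewrite -D'K ?aD //; exact: ab.
have opD i a : all D' a -> op M i (map_tuple (g s) a) = g s (op S' i a).
  move=> aD /=; case: ifP => ab; last first.
    by rewrite aD hK //; apply: cE; exact: mapE.
  rewrite map_old // aop ?dom_old // gs_old //.
  by apply: cS; exact/allP.
have rkD a : all D' a -> rk M (map_tuple (g s) a) = rk S' a.
  move=> aD /=; case: ifP => ab; last by rewrite aD.
  by rewrite map_old // ark ?dom_old.
have opD' i a : all D' a -> D' (op S' i a).
  move=> aD /=; case: ifP => ab.
    rewrite D'K; last by apply: cS; exact/allP.
    by apply: (fin_closed (fin_dom s vst)); apply/allP; exact: dom_old.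
  by rewrite aD; apply: hD; apply: cE; exact: mapE.
have en_sub a x : x \in en a -> (x < K') /\ sp x \subset usupp sp a.
  by rewrite mem_filter mem_iota => /andP [].
have cS' : op_closed S' (fun x => below st' x).
  move=> i a aK; have [ab|nab] := boolP (all (below st) a).
    rewrite /= ab; apply: (leq_trans _ KK'); apply: cS; exact/allP.
  have [aD|naD] := boolP (all D' a); first by case/andP: (opD' i a aD).
  rewrite /= (negbTE nab) (negbTE naD).
  have [ie|ie] := ltnP i (size (en a)).
    by have [] := en_sub a _ (mem_nth (head 0 a) ie).
  by rewrite nth_default //; apply: aK; exact: head_mem.
exists st'; split=> //=; first split.
- split.
  + split=> [//|a aK|b bK].
    * rewrite /B2_at /=; case: ifP => [ab|nab].
        by move=> i; exact: S2.
      case: ifP => [aD|naD] i; last by move=> ie; rewrite nth_default // ltnW.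
      by move=> /M2 ->; rewrite head_map_tuple hVK //; apply: (allP aD); exact: head_mem.
    * move=> ub sb; have [bb|nbb] := boolP (all (below st) b).
        rewrite -[b]map_id; apply/(dep_image (P := str st) (D := below st)) => //.
        - move=> i a /allP ab; rewrite (_ : map_tuple _ a = a) /= ?ab //.
          by apply: val_inj; rewrite /= map_id.
        - exact/allP.
        - exact: S3.
      have [bD|nbD] := boolP (all D' b).
        apply/(dep_image (P := S') (Q := M) (D := D') (g := g s)) => //.
        - by move=> i a /allP; exact: opD'.
        - by move=> i a /allP; exact: opD.
        - exact/allP.
        - apply: M3; rewrite ?size_map // map_inj_in_uniq // => x y /(allP bD) ? /(allP bD) ?.
          exact: gi.
      (* The mixed case of (B3): a new [y] in [b] has support [s], so some [n]-tuple from [b]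
         containing [y] has the full support of [b], and it enumerates [b]. *)
      have /allPn [y yb yK] := nbb.
      have spy : sp y = s by rewrite /sp ifF //; exact: negbTE.
      have [a [ya ab ba]] := mixed_tuple yb spy.
      apply: (dep_tuple (a := a)) => // x xb.
      have nab : ~~ all (below st) a by apply/allPn; exists y.
      (* Otherwise the support of every element of [b] would lie in [s], and so [z] would be in
         [D']. *)
      have naD : ~~ all D' a.
        have /allPn [z zb zD] := nbD; apply: contra zD => /allP aD.
        apply/andP; split; first exact: (allP bK).
        apply: subset_trans (supp_usupp sp zb) _.
        by apply: subset_trans ba _; apply/usuppP => w /aD /andP [].
      have xen : x \in en a.
        rewrite mem_filter mem_iota; apply/andP; split; last exact: (allP bK).
        by apply: subset_trans ba; exact: supp_usupp.
      by exists (index x (en a)); rewrite /= (negbTE nab) (negbTE naD) nth_index.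
  + move=> i a aK /=; case: ifP => [ab|nab].
      have oK : op (str st) i a < K by apply: cS; exact/allP.
      rewrite {1}/sp oK; rewrite (eq_in_usupp (g := supp st)); first exact: sS.
      by move=> x /(allP ab) xK; rewrite /sp ifT.
    case: ifP => [aD|naD].
      have /andP [_ os] : D' (h (op M i (map_tuple (g s) a))).
        by apply: hD; apply: cE; exact: mapE.
      have /allPn [y ya yK] : ~~ all (below st) a by rewrite nab.
      apply: subset_trans os _; have := supp_usupp sp ya.
      by rewrite {1}/sp ifF //; exact: negbTE.
    have [ie|ie] := ltnP i (size (en a)).
      by have [] := en_sub a _ (mem_nth (head 0 a) ie).
    by rewrite nth_default //; apply: supp_usupp; exact: head_mem.
  + move=> x y xK yK /(_ (N + x)) /=; rewrite ltn_add2l => /(_ xK).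
    by rewrite ltnNge leq_addr /= eqxx => /esym /eqP; lia.
  + move=> t; have [->|ts] := eqVneq t s; first exact: gi.
    have gB x : x < K -> g t x < B.
      move=> xK; rewrite /g xK ltnS; apply: leq_trans (leq_bigmax t).
      exact: (leq_bigmax (Ordinal xK)).
    have gB' x : ~~ (x < K) -> g t x = B + x by rewrite /g (negbTE ts) => /negbTE ->.
    move=> x y /andP [/= xK' xt] /andP [/= yK' yt].
    have [xK|xK] := boolP (x < K); have [yK|yK] := boolP (y < K).
    * have dold z : z < K -> sp z \subset t -> dom st t z.
        by move=> zK; rewrite /dom /sp -/K zK.
      by rewrite /g xK yK; apply: injS; exact: dold.
    * have := gB _ xK; rewrite (gB' _ yK); lia.
    * have := gB _ yK; rewrite (gB' _ xK); lia.
    * rewrite !gB' //; lia.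
- split=> //=.
  + by apply: leq_trans sN _; rewrite leq_addr.
  + by move=> i a ->.
  + by move=> a ->.
  + move=> x i xK iN; rewrite (leq_trans iN sN); case: ifP => // Dx.
    by rewrite gs_old // alb // -D'K.
  + by move=> x xK; rewrite /sp ifT.
  + by move=> t x xK; rewrite /g ifT.
- exact: leq_addr.
- by split=> // x i Dx iN /=; rewrite iN ifT.
- by move=> x /andP [xK _]; rewrite /sp ifF // ltnNge xK.
Qed.

End States.

(** * Limits of chains *)

Section Embeddings.
Context (m : nat).
Let n := m.+1.
Implicit Types (a : n.-tuple nat) (b l : seq nat) (P Q S : pre n).

Record embedding P Q (h : nat -> nat) : Prop := {
  emb_inj : injective h ;
  emb_op : forall i a, op Q i (map_tuple h a) = h (op P i a) ;
  emb_rk : forall a, rk Q (map_tuple h a) = rk P a ;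
  emb_lb : forall x i, lb Q (h x) i = lb P x i
}.

Definition embeds P Q := exists h, embedding P Q h.

Lemma embedding_comp P Q S g h :
  embedding P Q g -> embedding Q S h -> embedding P S (h \o g).
Proof.
move=> [gi go gr gl] [hi ho hr hl].
have cE a : map_tuple (h \o g) a = map_tuple h (map_tuple g a).
  by apply: val_inj; rewrite /= map_comp.
split; first exact: inj_comp.
- by move=> i a; rewrite cE ho go.
- by move=> a; rewrite cE hr gr.
- by move=> x i; rewrite /= hl gl.
Qed.

Lemma embeds_trans P Q S : embeds P Q -> embeds Q S -> embeds P S.
Proof. by move=> [g gP] [h hP]; exists (h \o g); exact: embedding_comp gP hP. Qed.

Lemma good_embedding P Q h : embedding P Q h -> good Q -> good P.
Proof.
move=> [hi ho hr hl] [Q2 Q3 Q4 Ql].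
split.
- move=> a i; rewrite -hr => /Q2; rewrite ho head_map_tuple; exact: hi.
- move=> b ub sb; apply/(dep_image (D := fun=> True) (Q := Q) (g := h)) => //.
    by move=> x y _ _; exact: hi.
  by apply: Q3; rewrite ?map_inj_uniq ?size_map.
- move=> l; have [d ld cd] := Q4 (map h l).
  pose k z := xget 0 [set y | h y = z]%classic.
  have hk y : k (h y) = y.
    by apply: hi; apply: (@xgetPex _ 0 [set y' | h y' = h y]%classic); exists y.
  (* The preimage of [d]; [k] is a left inverse of [h]. *)
  exists [seq y <- map k d | h y \in d].
    move=> x xl; have hd : h x \in d by apply: ld; exact: map_f.
    by rewrite mem_filter hd -[x]hk map_f.
  move=> i a aD; suff hd : h (op P i a) \in d by rewrite mem_filter hd -[op P i a]hk map_f.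
  rewrite -ho; apply: cd => _ /mapP [y /aD + ->].
  by rewrite mem_filter => /andP [].
- by move=> x y xy; apply: hi; apply: Ql => i; rewrite !hl.
Qed.

End Embeddings.

(** * The limit of a chain of states and the models read off from it *)

Section Limit.
Context (m : nat).
Let n := m.+1.
Implicit Types (a : n.-tuple nat) (b l : seq nat) (P Q S : pre n) (s : {set 'I_m}).

Lemma extends_trans (st1 st2 st3 : state m) :
  extends st1 st2 -> extends st2 st3 -> extends st1 st3.
Proof.
move=> [t1 d1 o1 r1 l1 s1 e1] [t2 d2 o2 r2 l2 s2 e2].
have b12 x : below st1 x -> below st2 x by move=> /leq_trans; apply.
split.
- exact: leq_trans t2.
- exact: leq_trans d2.
- by move=> i a ab; rewrite o2 ?o1 //; apply: sub_all ab.
- by move=> a ab; rewrite r2 ?r1 //; apply: sub_all ab.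
- by move=> x i xb id; rewrite l2 ?l1 // ?b12 //; exact: leq_trans d1.
- by move=> x xb; rewrite s2 ?s1 // b12.
- by move=> s x xb; rewrite e2 ?e1 // b12.
Qed.

Lemma extends_refl (st : state m) : extends st st.
Proof. by split. Qed.

Context (st : nat -> state m).
Context (st_valid : forall t, valid (st t)).
Context (st_ext : forall t, extends (st t) (st t.+1)).
Context (st_top : forall t, t <= top (st t)).
Context (st_depth : forall t, t <= depth (st t)).
Context (st_surj : forall s y, exists t x, dom (st t) s x /\ emb (st t) s x = y).

Lemma st_mono t t' : t <= t' -> extends (st t) (st t').
Proof.
move=> /subnK <-; elim: (t' - t) => [|k IH]; first exact: extends_refl.
by rewrite addSn; apply: extends_trans IH _.
Qed.

Definition stage (a : seq nat) := (\max_(x <- a) x).+1.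

Lemma stage_below (a : seq nat) t : stage a <= t -> all (below (st t)) a.
Proof.
move=> at_; apply/allP => x xa; rewrite /below.
apply: leq_trans (st_top t); apply: leq_trans at_; rewrite ltnS.
exact: leq_bigmax_seq.
Qed.

(** Each value is read at a stage late enough for its arguments, and [extends] makes the choice of
    stage immaterial. For a label the stage must also exceed [i], so that [i] is below the depth. *)
Definition limit_pre := @Pre n
  (fun i a => op (str (st (stage a))) i a)
  (fun a => rk (str (st (stage a))) a)
  (fun x i => lb (str (st (maxn x i).+1)) x i).

Definition limit_supp x := supp (st x.+1) x.
Definition limit_emb s x := emb (st x.+1) s x.

Lemma below1 x : below (st x.+1) x.
Proof. exact: st_top. Qed.

Lemma limit_op t i a : all (below (st t)) a -> op limit_pre i a = op (str (st t)) i a.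
Proof.
move=> ab; rewrite /=; have [l|/ltnW l] := leqP t (stage a).
  exact: (ext_op (st_mono l)).
by apply/esym/(ext_op (st_mono l)); exact: stage_below.
Qed.

Lemma limit_rk t a : all (below (st t)) a -> rk limit_pre a = rk (str (st t)) a.
Proof.
move=> ab; rewrite /=; have [l|/ltnW l] := leqP t (stage a).
  exact: (ext_rk (st_mono l)).
by apply/esym/(ext_rk (st_mono l)); exact: stage_below.
Qed.

Lemma limit_lb t x i : below (st t) x -> i < depth (st t) ->
  lb limit_pre x i = lb (str (st t)) x i.
Proof.
move=> xb id; rewrite /=; have [l|/ltnW l] := leqP t (maxn x i).+1.
  exact: (ext_lb (st_mono l)).
apply/esym/(ext_lb (st_mono l)).
  by apply: leq_trans (st_top _); rewrite ltnS leq_maxl.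
by apply: leq_trans (st_depth _); rewrite ltnS leq_maxr.
Qed.

Lemma limit_suppE t x : below (st t) x -> limit_supp x = supp (st t) x.
Proof.
move=> xb; rewrite /limit_supp; have [l|/ltnW l] := leqP t x.+1.
  exact: (ext_supp (st_mono l)).
by apply/esym/(ext_supp (st_mono l)); exact: below1.
Qed.

Lemma limit_embE t s x : below (st t) x -> limit_emb s x = emb (st t) s x.
Proof.
move=> xb; rewrite /limit_emb; have [l|/ltnW l] := leqP t x.+1.
  exact: (ext_emb (st_mono l)).
by apply/esym/(ext_emb (st_mono l)); exact: below1.
Qed.

(** Each clause concerns finitely many elements and is inherited from a stage; for local finiteness,
    the elements below [top] at a stage form a closed set. *)
Lemma limit_good : good limit_pre.
Proof.
have bstage a : all (below (st (stage a))) a by exact: stage_below.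
split.
- move=> a; rewrite /B2_at; have [[_ B2 _] _ _ _] := st_valid (stage a).
  exact: (B2 _ (bstage a)).
- move=> b ub sb; have bb : all (below (st (stage b))) b by exact: stage_below.
  have [[cS _ B3] _ _ _] := st_valid (stage b).
  rewrite -[b]map_id.
  apply/(dep_image (P := str (st (stage b))) (D := below (st (stage b)))) => //.
  + move=> i a /allP ab; rewrite (_ : map_tuple _ a = a); first by rewrite (limit_op _ ab).
    by apply: val_inj; rewrite /= map_id.
  + exact/allP.
  + exact: B3.
- move=> l; exists (iota 0 (top (st (stage l)))) => [x xl|i a aD].
    have /allP /(_ x xl) : all (below (st (stage l))) l by exact: stage_below.
    by rewrite mem_iota.
  have [[cS _ _] _ _ _] := st_valid (stage l).
  have ab : {in a, forall x, below (st (stage l)) x} by move=> x /aD; rewrite mem_iota.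
  by rewrite mem_iota (@limit_op (stage l)) //; [exact: cS|apply/allP].
- move=> x y xy; pose t := (maxn x y).+1.
  have xt : below (st t) x by apply: leq_trans (st_top t); rewrite ltnS leq_maxl.
  have yt : below (st t) y by apply: leq_trans (st_top t); rewrite ltnS leq_maxr.
  by apply: (v_lb (st_valid t)) => // i id; rewrite -!limit_lb.
Qed.

Lemma limit_op_supp i a : limit_supp (op limit_pre i a) \subset usupp limit_supp a.
Proof.
have ab : all (below (st (stage a))) a by exact: stage_below.
have [[cS _ _] sS _ _] := st_valid (stage a).
rewrite (limit_suppE (t := stage a)); last by apply: cS; exact/allP.
rewrite (eq_in_usupp (g := supp (st (stage a)))); first exact: sS.
by move=> x /(allP ab); exact: limit_suppE.
Qed.

Lemma limit_emb_inj s x y : limit_supp x \subset s -> limit_supp y \subset s ->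
  limit_emb s x = limit_emb s y -> x = y.
Proof.
pose t := (maxn x y).+1.
have xt : below (st t) x by apply: leq_trans (st_top t); rewrite ltnS leq_maxl.
have yt : below (st t) y by apply: leq_trans (st_top t); rewrite ltnS leq_maxr.
rewrite !(limit_suppE (t := t)) // !(limit_embE (t := t)) // => xs ys.
by apply: (v_inj (st_valid t)); apply/andP.
Qed.

Lemma limit_emb_surj s y : exists x, limit_supp x \subset s /\ limit_emb s x = y.
Proof.
have [t [x [/andP [xt xs] <-]]] := st_surj s y.
by exists x; rewrite (limit_suppE (t := t)) // (limit_embE (t := t)).
Qed.

(** [limit_emb s] maps the elements with support in [s] bijectively onto nat; [N s] is that part of
    the limit moved to nat. *)
Lemma limit_family : exists N : {set 'I_m} -> pre n,
  [/\ forall s, good (N s),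
      forall s t, agree (dom (st t) s) (depth (st t)) (emb (st t) s) (str (st t)) (N s),
      forall s s', s \subset s' -> embeds (N s) (N s') &
      forall s s', embeds (N s) (N s') ->
        forall t x, dom (st t) s x -> dom (st t) s' x].
Proof.
have /choice [h hP] : forall p : {set 'I_m} * nat, exists x,
    limit_supp x \subset p.1 /\ limit_emb p.1 x = p.2.
  by move=> [s y]; exact: limit_emb_surj.
have hs s y : limit_supp (h (s, y)) \subset s by have [] := hP (s, y).
have hK s y : limit_emb s (h (s, y)) = y by have [] := hP (s, y).
have hVK s x : limit_supp x \subset s -> h (s, limit_emb s x) = x.
  by move=> xs; apply: (limit_emb_inj (hs _ _) xs); rewrite hK.
have hmap s a : map_tuple (limit_emb s) (map_tuple (fun y => h (s, y)) a) = a.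
  apply: val_inj; rewrite /= -map_comp -[RHS]map_id; apply: eq_map => y /=.
  exact: hK.
have hmap' s a : {in a, forall x, limit_supp x \subset s} ->
    map_tuple (fun y => h (s, y)) (map_tuple (limit_emb s) a) = a.
  move=> aS; apply: val_inj; rewrite /= -map_comp -[RHS]map_id.
  by apply/eq_in_map => y /aS /hVK.
have map_hs s a : {in map_tuple (fun y => h (s, y)) a, forall x, limit_supp x \subset s}.
  by move=> _ /mapP [y _ ->].
have op_s s i a : {in a, forall x, limit_supp x \subset s} ->
    limit_supp (op limit_pre i a) \subset s.
  by move=> aS; apply: subset_trans (limit_op_supp i a) _; exact/usuppP.
pose N s := @Pre n
  (fun i a => limit_emb s (op limit_pre i (map_tuple (fun y => h (s, y)) a)))
  (fun a => rk limit_pre (map_tuple (fun y => h (s, y)) a))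
  (fun y i => lb limit_pre (h (s, y)) i).
have opN s i a : op (N s) i a =
    limit_emb s (op limit_pre i (map_tuple (fun y => h (s, y)) a)) by [].
have rkN s a : rk (N s) a = rk limit_pre (map_tuple (fun y => h (s, y)) a) by [].
have lbN s y i : lb (N s) y i = lb limit_pre (h (s, y)) i by [].
have hN s : embedding (N s) limit_pre (fun y => h (s, y)).
  split=> //; first by move=> x y /(congr1 (limit_emb s)); rewrite !hK.
  by move=> i a; rewrite opN hVK //; apply: op_s; exact: map_hs.
exists N; split.
- by move=> s; exact: good_embedding (hN s) limit_good.
- move=> s t.
  have db x : dom (st t) s x -> below (st t) x by case/andP.
  have ds x : dom (st t) s x -> limit_supp x \subset s.
    by move=> Dx; rewrite (limit_suppE (db _ Dx)); case/andP: Dx.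
  have mapE a : all (dom (st t) s) a ->
      map_tuple (fun y => h (s, y)) (map_tuple (emb (st t) s) a) = a.
    move=> /allP aD; rewrite -[RHS](@hmap' s) => [|x /aD /ds //].
    congr map_tuple; apply: val_inj; apply/eq_in_map => x /aD /db xb.
    by rewrite (limit_embE _ xb).
  have [cS _ _] := fin_dom s (st_valid t).
  split.
  + move=> i a aD; rewrite opN mapE //.
    have ab : all (below (st t)) a by apply: sub_all aD.
    rewrite (limit_op _ ab) (limit_embE (t := t)) //.
    by apply: db; apply: cS; exact/allP.
  + move=> a aD; rewrite rkN mapE //; apply: limit_rk.
    by apply: sub_all aD.
  + move=> x i Dx id; rewrite lbN -(limit_embE s (db _ Dx)) hVK; last exact: ds.
    by apply: limit_lb => //; exact: db.
(* Read in the limit, this map is the inclusion of one part in the other. *)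
- move=> s s' ss'; exists (fun y => limit_emb s' (h (s, y))).
  have hs' y : limit_supp (h (s, y)) \subset s' by exact: subset_trans ss'.
  have mapE a : map_tuple (fun y => h (s', y))
      (map_tuple (fun y => limit_emb s' (h (s, y))) a) = map_tuple (fun y => h (s, y)) a.
    apply: val_inj; rewrite /= -map_comp; apply: eq_map => y /=.
    by rewrite hVK.
  split.
  + by move=> x y /limit_emb_inj-/(_ (hs' x) (hs' y)) /(congr1 (limit_emb s)); rewrite !hK.
  + move=> i a; rewrite !opN mapE [in RHS]hVK //.
    by apply: op_s; exact: map_hs.
  + by move=> a; rewrite !rkN mapE.
  + by move=> x i; rewrite !lbN hVK.
(* Embeddings preserve labels, and labels separate the elements of the limit. So [f], read in the
   limit, is the identity, and elements with support in [s] have support in [s']. *)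
- move=> s s' [f [_ _ _ fl]] t x Dx; have /andP [xb xs] := Dx.
  rewrite -(limit_suppE xb) in xs.
  have : h (s', f (limit_emb s x)) = x.
    apply: (good_lb limit_good) => i.
    have := fl (limit_emb s x) i; by rewrite !lbN hVK.
  move=> xE; apply/andP; split=> //.
  by rewrite -(limit_suppE xb) -xE.
Qed.

End Limit.

(** * Right-embeddings *)

Section StructEmbeddings.
Context (L : language).

Definition struct_embedding (M N : structure L nat) (h : nat -> nat) :=
  [/\ injective h, forall f a, @fint L nat N f (map_tuple h a) = h (@fint L nat M f a) &
      forall r a, @rint L nat N r (map_tuple h a) <-> @rint L nat M r a].

Definition struct_embeds M N := exists h, struct_embedding M N h.

End StructEmbeddings.

Lemma Sinf_inv_mul (f g : Sinf) k :
  Sinf_inv (f * g)%g k = Sinf_inv g (Sinf_inv f k).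
Proof.
apply: (can_inj (Sinf_invK (f * g)%g)); rewrite (Sinf_invVK (f * g)%g).
by rewrite Sinf_mulE (Sinf_invVK g) (Sinf_invVK f).
Qed.

(* Any injection agrees on {0, ..., i-1} with a bijection: correct it by one
   transposition at a time. *)
Lemma injection_approx (h : nat -> nat) i : injective h ->
  exists p : Sinf, forall k, k < i -> p k = h k.
Proof.
move=> hi; elim: i => [|i [p ph]]; first by exists 1%g.
pose u := p i; pose v := h i.
pose sw x := if x == u then v else if x == v then u else x.
have swK : involutive sw.
  move=> x; rewrite /sw; have [->|xu] := eqVneq x u.
    by rewrite eqxx; case: eqP.
  have [->|xv] := eqVneq x v; first by rewrite eqxx.
  by rewrite (negbTE xu) (negbTE xv).
exists (mkSinf (Bijective swK swK) * p)%g => k.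
rewrite ltnS leq_eqVlt Sinf_mulE => /predU1P [->|ki].
  by rewrite -[LHS]/(sw (p i)) /sw eqxx.
rewrite -[LHS]/(sw (p k)) /sw.
have -> : (p k == u) = false.
  apply/eqP => /(bij_inj (Sinf_bij p)) /eqP; lia.
by rewrite ph //; case: eqP => // /hi /eqP; lia.
Qed.

(** * A right-invariant metric on the permutation group *)

Section InverseMetric.
Context (R : realType).
Implicit Types f g : Sinf.
Local Open Scope ring_scope.

Definition inv_agree f g k := forall j, (j < k)%N -> Sinf_inv f j = Sinf_inv g j.

(** Here [k] is the first place where the inverses differ. Comparing inverses gives right
    invariance, as the inverse of [f * g] applies the inverse of [f] first. *)
Definition inv_dist f g : R :=
  match pselect (exists k, Sinf_inv f k != Sinf_inv g k) with
  | left e => (ex_minn e).+1%:R^-1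
  | right _ => 0
  end.

Lemma inv_dist_lt f g k : (inv_dist f g < k.+1%:R^-1 <-> inv_agree f g k.+1).
Proof.
rewrite /inv_dist; case: pselect => [e|ne].
  case: ex_minnP => j fgj jmin; rewrite ltf_pV2 ?posrE ?ltr0n // ltr_nat ltnS.
  split=> [kj i|fg].
    rewrite ltnS => ik; apply/eqP; apply: contraTT kj => /jmin; lia.
  by rewrite ltnNge; apply: contra fgj => jk; rewrite fg.
rewrite invr_gt0 ltr0n; split=> // _ j _; apply/eqP.
by apply: contrapT => /negP fgj; apply: ne; exists j.
Qed.

Lemma inv_dist_ge0 f g : 0 <= inv_dist f g.
Proof. by rewrite /inv_dist; case: pselect => // e; rewrite invr_ge0 ler0n. Qed.

Lemma inv_dist_eq0 f g : inv_dist f g = 0 <-> f = g.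
Proof.
split=> [fg0|->]; last first.
  by rewrite /inv_dist; case: pselect => // e; have [k] := e; rewrite eqxx.
have fg k : Sinf_inv f k = Sinf_inv g k.
  by have /inv_dist_lt : inv_dist f g < k.+1%:R^-1; [rewrite fg0 invr_gt0 ltr0n|apply].
apply: SinfP => k; apply: (can_inj (Sinf_invVK g)).
by rewrite [RHS](Sinf_invK g) -[LHS]fg [LHS](Sinf_invK f).
Qed.

(** The distance is 0 or some [1/(k+1)], so bounds on it reduce to agreement of inverses; symmetry,
    the triangle inequality and right invariance all use this. *)
Lemma inv_dist_le f g (e : R) : 0 <= e ->
  (forall k, e < k.+1%:R^-1 -> inv_agree f g k.+1) -> inv_dist f g <= e.
Proof.
move=> e0 fg; rewrite leNgt; apply/negP.
rewrite /inv_dist; case: pselect => [ex|]; last by rewrite ltNge e0.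
by case: ex_minnP => k + _ /fg /(_ k (ltnSn k)) => /eqP.
Qed.

Lemma inv_dist_sym f g : inv_dist f g = inv_dist g f.
Proof.
by apply/eqP; rewrite eq_le; apply/andP; split; apply: inv_dist_le => [|k /inv_dist_lt fg j jk];
  rewrite ?inv_dist_ge0 // fg.
Qed.

Lemma inv_dist_triangle f g h : inv_dist f h <= inv_dist f g + inv_dist g h.
Proof.
apply: inv_dist_le => [|k fgh j jk]; first by rewrite addr_ge0 ?inv_dist_ge0.
have /inv_dist_lt -> // : inv_dist f g < k.+1%:R^-1.
  by apply: le_lt_trans fgh; rewrite lerDl inv_dist_ge0.
have /inv_dist_lt -> // : inv_dist g h < k.+1%:R^-1.
by apply: le_lt_trans fgh; rewrite lerDr inv_dist_ge0.
Qed.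

Lemma inv_dist_metric : is_metric inv_dist.
Proof.
split; [exact: inv_dist_ge0|exact: inv_dist_eq0|exact: inv_dist_sym|].
by move=> x y z; exact: inv_dist_triangle.
Qed.

Lemma inv_dist_right_invariant : right_invariant_metric inv_dist.
Proof.
move=> g x y; apply/eqP; rewrite eq_le; apply/andP; split;
  apply: inv_dist_le => [|k /inv_dist_lt xy j jk]; rewrite ?inv_dist_ge0 //.
  by rewrite !Sinf_inv_mul xy.
by have := xy j jk; rewrite !Sinf_inv_mul => /(can_inj (Sinf_invVK g)).
Qed.

Lemma exists_invSn_lt (e : R) : 0 < e -> exists k, k.+1%:R^-1 < e.
Proof.
move=> e0; have [k] := ltr_add_invr (y := 0) e0; rewrite add0r => ke.
by exists k.
Qed.

Lemma inv_dist_compatible : compatible_metric inv_dist.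
Proof.
move=> x U; split=> [xU|[e e0 eU]].
  pose F := filter_from [set: nat]%classic (fun k => [set y | inv_agree x y k]%classic).
  have FF : Filter F.
    apply: filter_from_filter; first by exists 0%N.
    move=> i j _ _; exists (maxn i j) => // y xy.
    by split=> k ki; apply: xy; rewrite leq_max ki ?orbT.
  have : F U.
    have Fx : (F --> x)%classic.
      (* Inverses that agree at [x k] give [y k = x k], hence the bound [x k + 1]. *)
      apply/Sinf_cvgP => k; exists ((x : Sinf) k).+1 => // y xy.
      apply: (can_inj (Sinf_invVK y)); rewrite [LHS](Sinf_invK y) -[RHS]xy //.
      by rewrite [RHS](Sinf_invK x).
    exact: Fx.
  move=> [k _ kU]; exists k.+1%:R^-1; first by rewrite invr_gt0 ltr0n.
  by move=> y /inv_dist_lt xy; apply: kU => j jk; apply: xy; exact: ltnW.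
have [k ke] := exists_invSn_lt e0.
apply: filterS (Sinf_inv_near_tuple x (iota_tuple k.+1 0)) => y xy.
apply: eU; apply: lt_trans ke; apply/inv_dist_lt => j jk.
have := congr1 (fun t => tnth t (Ordinal jk)) xy.
by rewrite !tnth_map !(tnth_nth 0%N) /= -/(iota 0 k.+1) nth_iota.
Qed.

Lemma right_cauchy_inv_agree (g : nat -> Sinf) :
  (forall i j, (i <= j)%N -> inv_agree (g i) (g j) i) -> right_cauchy R g.
Proof.
move=> gg; exists inv_dist; split.
- exact: inv_dist_metric.
- exact: inv_dist_compatible.
- exact: inv_dist_right_invariant.
move=> e /exists_invSn_lt [k ke]; exists k.+1 => i j ki kj.
apply: lt_trans ke; apply/inv_dist_lt => l lk.
by rewrite -(gg k.+1 i ki) // (gg k.+1 j kj).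
Qed.

(** Right invariance turns the Cauchy condition into [g N * (g i)^-1] being close to the identity.
    This product then fixes [k], so the inverses of [g N] and [g i] agree at [k]. *)
Lemma right_cauchy_inv_cvg (g : nat -> Sinf) : right_cauchy R g ->
  exists h : nat -> nat, forall k, exists N, forall i, (N <= i)%N -> Sinf_inv (g i) k = h k.
Proof.
move=> [d [_ dc dr dg]].
suff /choice [h gh] : forall k, exists y, exists N, forall i, (N <= i)%N -> Sinf_inv (g i) k = y.
  by exists h.
move=> k; have /dc [e e0 eU] : nbhs (1%g : Sinf) [set h : Sinf | h k = k]%classic.
  exact: (Sinf_near 1%g k).
have [N gN] := dg e e0; exists (Sinf_inv (g N) k), N => i Ni.
have : d 1%g (g N * (g i)^-1)%g < e.
  by rewrite -(mulgV (g i)) dr; exact: gN.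
move=> /eU /= gk; apply: (can_inj (Sinf_invK (g N))).
by rewrite [RHS](Sinf_invVK (g N)).
Qed.

End InverseMetric.

(** * Right-embeddings as embeddings of models *)

Section RightEmbeds.
Context (R : realType) (L : language) (K : structure_class L).
Implicit Types x : Mod_omega K.

Lemma Mod_subbasis_nbhs x (U : set (XL L)) :
  XL_subbasis U -> U (val x) -> nbhs x (val @^-1` U)%classic.
Proof.
move=> sU Ux; have valc : {for x, continuous (val : Mod_set K -> XL L)}.
  exact: initial_continuous.
by apply: valc; exact: XL_subbasis_nbhs.
Qed.

Lemma Mod_cvg (F : set_system (Mod_omega K)) (FF : Filter F) x :
  (forall U, XL_subbasis U -> U (val x) -> F (val @^-1` U)%classic) -> (F --> x)%classic.
Proof.
move=> FU U [V [[W oW <-] Wx] VU].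
have vF : (val @ F --> (val x : XL L))%classic.
  by apply: XL_cvg.
have := vF W (open_nbhs_nbhs (conj oW Wx)).
by apply: (@filterS _ F) => y; exact: VU.
Qed.

Lemma right_embedsP x x' : right_embeds R x x' <-> struct_embeds (val x) (val x').
Proof.
split=> [[g /right_cauchy_inv_cvg [h hg] gx]|[h [hi hf hr]]].
  have eventually (U : set (XL L)) : XL_subbasis U -> U (val x) ->
      exists N, forall i, N <= i -> U (logic_act (g i) (val x')).
    move=> sU Ux; have [N _ NU] := gx _ (Mod_subbasis_nbhs sU Ux).
    by exists N => i Ni; exact: NU.
  have hmap k (a : k.-tuple nat) :
      exists N, forall i, N <= i -> map_tuple (Sinf_inv (g i)) a = map_tuple h a.
    have [N hN] := choice hg; exists (\max_(y <- a) N y) => i Ni.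
    apply: eq_from_tnth => j; rewrite !tnth_map; apply: hN.
    by apply: leq_trans Ni; apply: leq_bigmax_seq => //; exact: mem_tnth.
  exists h; split.
  - move=> u v huv; have [N1 h1] := hg u; have [N2 h2] := hg v.
    apply: (can_inj (Sinf_invVK (g (maxn N1 N2)))).
    by rewrite [LHS]h1 ?leq_maxl // [RHS]h2 ?leq_maxr.
  - move=> f a; set b := fint (val x) a.
    have [N1 h1] := eventually [set M : XL L | @fint L nat M f a = b]%classic
      ltac:(by right; right; exists f, a, b) erefl.
    have [N2 h2] := hmap _ a; have [N3 h3] := hg b.
    (* Late enough for the image of [x'] under [g i] to agree with [x] at [f a], and for the inverse
       of [g i] to agree with [h] on [a] and [b]. *)
    pose i := maxn N1 (maxn N2 N3).
    have /= := h1 i ltac:(by rewrite leq_maxl).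
    rewrite h2; last by rewrite /i; lia.
    by move=> gi; rewrite -(h3 i) -?gi ?[RHS](Sinf_invK (g i)) //; rewrite /i; lia.
  - move=> r a; have [N2 h2] := hmap _ a.
    split=> xr; apply: contrapT.
      move=> nr; have [N1 h1] := eventually [set M : XL L | ~ @rint L nat M r a]%classic
        ltac:(by right; left; exists r, a) nr.
      apply: (h1 (maxn N1 N2)); first by rewrite leq_maxl.
      by rewrite /= h2 // leq_maxr.
    have [N1 h1] := eventually [set M : XL L | @rint L nat M r a]%classic
      ltac:(by left; exists r, a) xr.
    have /= := h1 (maxn N1 N2) (leq_maxl _ _).
    by rewrite h2 ?leq_maxr // => xa; apply.
(* Conversely, [h] is approximated by bijections [p i] agreeing with it below [i]; their inverses
   form the required right-Cauchy sequence. *)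
have /choice [p pP] i := injection_approx i hi.
have pinv i k : Sinf_inv (p i)^-1%g k = p i k.
  apply: (can_inj (Sinf_invK (p i)^-1%g)); rewrite [LHS](Sinf_invVK (p i)^-1%g).
  by rewrite [RHS](Sinf_invK (p i)).
exists (fun i => (p i)^-1%g).
  apply: right_cauchy_inv_agree => i j ij k ki.
  by rewrite !pinv !pP // (leq_trans ki).
have pmap k (a : k.-tuple nat) i : \max_(y <- a) y < i ->
    map_tuple (Sinf_inv (p i)^-1%g) a = map_tuple h a.
  move=> ai; apply: eq_from_tnth => j; rewrite !tnth_map pinv pP //.
  by apply: leq_ltn_trans ai; apply: leq_bigmax_seq => //; exact: mem_tnth.
apply: Mod_cvg => U [[r [a ->]]|[[r [a ->]]|[f [a [b ->]]]]] /= Ux.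
- exists (\max_(y <- a) y).+1 => // i /= ai; rewrite pmap //; exact/hr.
- exists (\max_(y <- a) y).+1 => // i /= ai; rewrite pmap // => /hr; exact: Ux.
- exists (maxn b (\max_(y <- a) y)).+1 => // i /= ai; rewrite pmap; last lia.
  rewrite hf Ux -(pP i); last lia.
  exact: (Sinf_invK (p i)).
Qed.

End RightEmbeds.

(** * The topology of the space of models *)

Section ModelSpace.
Context (m : nat).
Let n := m.+1.
Notation X := (Mod_omega (labeled (BKL m.+1))).
Implicit Types (a : n.-tuple nat) (P Q S : pre n) (M : X).

Definition pre_of M : pre n := of_struct (set_mem (valP M)).

Lemma to_struct_pre_of M : to_struct (pre_of M) = val M.
Proof. exact: of_structK. Qed.

Lemma val_rk M j a :
  @rint (hat_lang (bkl_lang n)) nat (val M) (inl j) a = (rk (pre_of M) a = j).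
Proof. by rewrite -[in LHS]to_struct_pre_of. Qed.

Lemma val_op M i a :
  @fint (hat_lang (bkl_lang n)) nat (val M) i a = op (pre_of M) i a.
Proof. by rewrite -[in LHS]to_struct_pre_of. Qed.

Lemma val_lb M i (t : 1.-tuple nat) :
  @rint (hat_lang (bkl_lang n)) nat (val M) (inr i) t = lb (pre_of M) (tnth t ord0) i.
Proof. by rewrite -[in LHS]to_struct_pre_of. Qed.

Lemma pre_of_good M : good (pre_of M).
Proof. by apply/goodP => //; rewrite to_struct_pre_of; exact: set_mem (valP M). Qed.

Definition model P (gP : good P) : X :=
  exist _ (to_struct P) (mem_set (proj2 (goodP P (ltn0Sn m)) gP)).

Lemma to_struct_fint P i a :
  @fint (hat_lang (bkl_lang n)) nat (to_struct P) i a = op P i a.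
Proof. by []. Qed.

Lemma to_struct_lb P (x i : nat) :
  @rint (hat_lang (bkl_lang n)) nat (to_struct P) (inr i) [tuple x] = lb P x i.
Proof. by []. Qed.

Lemma pre_of_model P (gP : good P) : pre_of (model gP) = P.
Proof.
have E := to_struct_pre_of (model gP); set Q := pre_of _ in E *.
have Eo i a : op Q i a = op P i a by rewrite -!to_struct_fint E.
have Er a : rk Q a = rk P a.
  have : @rint (hat_lang (bkl_lang n)) nat (to_struct Q) (inl (rk P a)) a by rewrite E.
  by [].
have El x i : lb Q x i = lb P x i.
  have : (lb Q x i : Prop) = lb P x i by rewrite -!to_struct_lb E.
  by move=> e; apply/idP/idP; rewrite e.
clearbody Q; case: Q P {gP E} Eo Er El => [o r l] [o' r' l'] /= Eo Er El.
congr Pre.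
- by apply/funext => i; apply/funext => a.
- exact/funext.
- by apply/funext => x; apply/funext => i.
Qed.

Lemma struct_embedsP M M' : struct_embeds (val M) (val M') <-> embeds (pre_of M) (pre_of M').
Proof.
rewrite -[in X in X <-> _](to_struct_pre_of M) -[in X in X <-> _](to_struct_pre_of M').
move: (pre_of M) (pre_of M') => P Q.
split=> -[h].
  move=> [hi ho hr]; exists h; split=> //.
  - by move=> a; exact: (proj2 (hr (inl (rk P a)) a) erefl).
  - move=> x i; have [h1 h2] := hr (inr i) [tuple x].
    by apply/idP/idP.
move=> [hi ho hr hl]; exists h; split=> // -[j|i] t /=.
  by rewrite hr.
by rewrite tnth_map hl.
Qed.

(** As [L] varies, these conditions give a neighbourhood base at a model. *)
Definition agree_below L P Q :=
  [/\ forall i a, all (gtn L) a -> op Q i a = op P i a,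
      forall a, all (gtn L) a -> rk Q a = rk P a &
      forall x i, x < L -> i < L -> lb Q x i = lb P x i].

Lemma agree_below_le L L' P Q : L <= L' -> agree_below L' P Q -> agree_below L P Q.
Proof.
move=> LL' [o r l]; have s : subpred (gtn L) (gtn L').
  by move=> x /= xL; exact: leq_trans LL'.
split=> [i a /(sub_all s)|a /(sub_all s)|x i xL iL]; [exact: o|exact: r|].
by apply: l; exact: leq_trans LL'.
Qed.

Lemma nbhs_agree_below M L : nbhs M [set M' | agree_below L (pre_of M) (pre_of M')]%classic.
Proof.
have hr (a : n.-tuple 'I_L) : nbhs M [set M' |
    rk (pre_of M') (map_tuple val a) = rk (pre_of M) (map_tuple val a)]%classic.
  set b := map_tuple val a.
  have sU : XL_subbasis [set N : XL (hat_lang (bkl_lang n)) |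
      @rint _ nat N (inl (rk (pre_of M) b)) b]%classic.
    by left; exists (inl (rk (pre_of M) b)), b.
  apply: filterS (Mod_subbasis_nbhs sU _) => [M'|].
    by rewrite /preimage /mkset ?val_rk ?val_op ?val_lb.
  by rewrite /mkset ?val_rk ?val_op ?val_lb.
have ho (a : n.-tuple 'I_L) i : nbhs M [set M' |
    op (pre_of M') i (map_tuple val a) = op (pre_of M) i (map_tuple val a)]%classic.
  set b := map_tuple val a.
  have sU : XL_subbasis [set N : XL (hat_lang (bkl_lang n)) |
      @fint _ nat N i b = op (pre_of M) i b]%classic.
    by right; right; exists i, b, (op (pre_of M) i b).
  apply: filterS (Mod_subbasis_nbhs sU _) => [M'|].
    by rewrite /preimage /mkset ?val_rk ?val_op ?val_lb.
  by rewrite /mkset ?val_rk ?val_op ?val_lb.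
have hl (x i : 'I_L) : nbhs M [set M' | lb (pre_of M') x i = lb (pre_of M) x i]%classic.
  case E : (lb (pre_of M) x i).
    have sU : XL_subbasis [set N : XL (hat_lang (bkl_lang n)) |
        @rint _ nat N (inr (i : nat)) [tuple x : nat]]%classic.
      by left; exists (inr (i : nat)), [tuple x : nat].
    apply: filterS (Mod_subbasis_nbhs sU _) => [M'|].
      by rewrite /preimage /mkset ?val_rk ?val_op ?val_lb.
    by rewrite /mkset ?val_rk ?val_op ?val_lb.
  have sU : XL_subbasis [set N : XL (hat_lang (bkl_lang n)) |
      ~ @rint _ nat N (inr (i : nat)) [tuple x : nat]]%classic.
    by right; left; exists (inr (i : nat)), [tuple x : nat].
  apply: filterS (Mod_subbasis_nbhs sU _) => [M'|].
    by rewrite /preimage /mkset val_lb => /negP/negbTE.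
  by rewrite /mkset val_lb [lb _ _ _]E.
(* By (B2), a bound on the ranks leaves only finitely many operations to control. *)
pose J := (\max_(a : n.-tuple 'I_L) rk (pre_of M) (map_tuple val a)).+1.
have H1 := filter_forall (nbhs_filter M) hr.
have H2 := filter_forall (nbhs_filter M)
  (fun t => filter_forall (nbhs_filter M) (fun i : 'I_J => ho t i)).
have H3 := filter_forall (nbhs_filter M)
  (fun x => filter_forall (nbhs_filter M) (fun i => hl x i)).
apply: filterS (filterI H1 (filterI H2 H3)) => M' [E1 [E2 E3]].
have lift a : all (gtn L) a -> exists a' : n.-tuple 'I_L, map_tuple val a' = a.
  move=> /all_tnthP aL; exists [tuple Ordinal (aL k) | k < n].
  by apply: eq_from_tnth => k; rewrite tnth_map tnth_mktuple.
split=> [i a /lift [a' <-]|a /lift [a' <-]|x i xL iL]; last first.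
- exact: (E3 (Ordinal xL) (Ordinal iL)).
- exact: E1.
  have [iJ|Ji] := ltnP i J; first exact: (E2 a' (Ordinal iJ)).
  have ri : rk (pre_of M) (map_tuple val a') < i.
    by apply: leq_trans Ji; rewrite ltnS; exact: (leq_bigmax a').
  have ri' : rk (pre_of M') (map_tuple val a') < i by have -> := E1 a'.
  by rewrite (goodB2 (pre_of_good M) ri) (goodB2 (pre_of_good M') ri').
Qed.

Lemma nbhsP_agree_below M (U : set X) : nbhs M U ->
  exists L, forall M', agree_below L (pre_of M) (pre_of M') -> U M'.
Proof.
move=> MU; pose F := filter_from [set: nat]%classic
  (fun L => [set M' | agree_below L (pre_of M) (pre_of M')]%classic).
have FF : Filter F.
  apply: filter_from_filter; first by exists 0.
  move=> i j _ _; exists (maxn i j) => // M' H.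
  by split; apply: agree_below_le H; rewrite ?leq_maxl ?leq_maxr.
suff FM : (F --> M)%classic by have [L _ LU] := FM U MU; exists L => M' /LU.
have bd (t : seq nat) L : \max_(x <- t) x < L -> all (gtn L) t.
  move=> tL; apply/allP => x xt; apply: leq_ltn_trans tL; exact: leq_bigmax_seq.
apply: Mod_cvg => V [[[j|i] [t ->]]|[[[j|i] [t ->]]|[i [t [y ->]]]]];
  rewrite /mkset ?val_rk ?val_op ?val_lb => Mt.
- exists (\max_(x <- t) x).+1 => // M' [_ r _].
  by rewrite /preimage /mkset ?val_rk ?val_op ?val_lb r // bd.
- exists (maxn (tnth t ord0) i).+1 => // M' [_ _ l].
  by rewrite /preimage /mkset ?val_rk ?val_op ?val_lb l ?ltnS ?leq_maxl ?leq_maxr.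
- exists (\max_(x <- t) x).+1 => // M' [_ r _].
  by rewrite /preimage /mkset ?val_rk ?val_op ?val_lb r // bd.
- exists (maxn (tnth t ord0) i).+1 => // M' [_ _ l].
  by rewrite /preimage /mkset ?val_rk ?val_op ?val_lb l ?ltnS ?leq_maxl ?leq_maxr.
- exists (\max_(x <- t) x).+1 => // M' [o _ _].
  by rewrite /preimage /mkset ?val_rk ?val_op ?val_lb o // bd.
Qed.

(** If every model agreeing with [M] below [L] were in the closure of [F], then [M] would be
    interior to that closure. *)
Lemma nowhere_dense_avoid M L (F : set X) : nowhere_dense F ->
  exists2 M1 : X, agree_below L (pre_of M) (pre_of M1) &
  exists L1, forall M2, agree_below L1 (pre_of M1) (pre_of M2) -> ~ F M2.
Proof.
move=> F0; apply: contrapT => no.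
suff : (interior (topology_structure.closure F) M) by rewrite F0.
apply: filterS (nbhs_agree_below M L) => M1 M1L; apply: contrapT => nc.
apply: no; exists M1 => //.
have [B BM1 FB] : exists2 B, nbhs M1 B & ~ (F `&` B !=set0)%classic.
  apply: contrapT => nB; apply: nc => B BM1; apply: contrapT => FB.
  by apply: nB; exists B.
have [L1 L1B] := nbhsP_agree_below BM1; exists L1 => M2 /L1B BM2 FM2.
by apply: FB; exists M2.
Qed.

End ModelSpace.

(** * Cubes *)

Section UpperBound.
Context (m : nat).
Let n := m.+1.
Implicit Types (a : n.-tuple nat) (P Q S : pre n).

Lemma embedding_factor P P' Q h h' g : embedding P Q h -> embedding P' Q h' ->
  (forall y, h' (g y) = h y) -> embedding P P' g.
Proof.
move=> [hi ho hr hl] [hi' ho' hr' hl'] gh.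
have mE a : map_tuple h' (map_tuple g a) = map_tuple h a.
  by apply: val_inj; rewrite /= -map_comp; apply: eq_map.
split.
- by move=> x y xy; apply: hi; rewrite -!gh xy.
- by move=> i a; apply: hi'; rewrite -ho' mE ho gh.
- by move=> a; rewrite -hr' mE hr.
- by move=> x i; rewrite -hl' gh hl.
Qed.

Lemma cube_bound k (P : {set 'I_k} -> pre n) : (forall s, good (P s)) ->
  (forall s t, embeds (P s) (P t) <-> s \subset t) -> k <= m.
Proof.
move=> gP PE; rewrite leqNgt; apply/negP => mk.
pose w (i : 'I_n) : 'I_k := widen_ord mk i.
have /choice [h hP] s : exists h, embedding (P s) (P setT) h.
  by apply/PE; exact: subsetT.
have [Q2 Q3 Q4 Ql] := gP setT.
pose rng s z := exists y, h s y = z.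
(* Separating labels force an embedding of [P s] in [P t] to commute with those into [P setT], so
   the images are nested. *)
have rng_sub (s t : {set 'I_k}) z : s \subset t -> rng s z -> rng t z.
  move=> /PE [g [_ _ _ gl]] [y <-]; exists (g y); apply: Ql => i.
  by rewrite (emb_lb (hP t)) gl (emb_lb (hP s)).
have rng_closed s : op_closed (P setT) (rng s).
  move=> i a /= aR; pose c z := xget 0 [set y | h s y = z]%classic.
  have cP z : z \in a -> h s (c z) = z.
    move=> /aR [y yz].
    by apply: (@xgetPex _ 0 [set y | h s y = z]%classic); exists y.
  exists (op (P s) i (map_tuple c a)); rewrite -(emb_op (hP s)); congr op.
  apply: val_inj; rewrite /= -map_comp -[RHS]map_id; apply/eq_in_map => z.
  exact: cP.
(* Otherwise the image of [P [set i]] would lie in that of [P (~: [set i])], giving an embedding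
   that the cube excludes. *)
have /choice [z zP] (i : 'I_k) : exists z, rng [set i] z /\ ~ rng (~: [set i]) z.
  apply: contrapT => no.
  have /choice [g gP'] y : exists y', h (~: [set i]) y' = h [set i] y.
    apply: contrapT => ny; apply: no; exists (h [set i] y).
    by split; [exists y|move=> [y' yy']; apply: ny; exists y'].
  have : embeds (P [set i]) (P (~: [set i])).
    by exists g; exact: embedding_factor (hP _) (hP _) gP'.
  by move=> /PE; rewrite sub1set !inE eqxx.
have z_other i j : i != j -> rng (~: [set i]) (z j).
  by move=> ij; apply: rng_sub (proj1 (zP j)); rewrite sub1set !inE eq_sym.
have zinj : injective z.
  move=> i j zij; apply/eqP; apply: contrapT => /negP /z_other.
  by rewrite -zij; exact: (proj2 (zP i)).
pose b := [seq z (w i) | i <- enum 'I_n].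
have ub : uniq b.
  rewrite map_inj_uniq ?enum_uniq // => i j /zinj /(congr1 val) /= ij.
  exact: val_inj.
have [d bd cd] := Q4 b.
(* The image of [P set0] is infinite and [d] is a finite list. *)
have [y yd] : exists y, h set0 y \notin d.
  apply: contrapT => no; pose l := map (h set0) (iota 0 (size d).+1).
  have ul : uniq l by rewrite map_inj_uniq ?iota_uniq //; exact: (emb_inj (hP _)).
  have ld : {subset l <= d}.
    move=> _ /mapP [y _ ->]; apply: contrapT => /negP yd; apply: no; by exists y.
  by have := uniq_leq_size ul ld; rewrite size_map size_iota ltnn.
have ub' : uniq (h set0 y :: b) by rewrite /= ub andbT; apply: contra yd; exact: bd.
have sb : size (h set0 y :: b) = n.+1 by rewrite /= size_map size_enum_ord.
have [x] := Q3 _ ub' sb.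
rewrite inE => /predU1P [->|/mapP [i _ ->]] {x} gx.
  apply: (negP yd); apply: (gx (fun v => v \in d)) => // x [].
  by rewrite inE => /predU1P [->|/bd//]; rewrite eqxx.
(* The closed set [rng (~: [set w i])] contains all other elements of the list but not [z (w i)]. *)
apply: (proj2 (zP (w i))); apply: gx => [|x []]; first exact: rng_closed.
rewrite inE => /predU1P [-> _|/mapP [j _ ->] ji].
  by apply: (rng_sub set0); [exact: sub0set|exists y].
by apply: z_other; apply: contraNneq ji => ->.
Qed.

End UpperBound.

(** * Building a cube in an open set outside a meager set *)

Section GenericCube.
Context (m : nat).
Let n := m.+1.
Notation X := (Mod_omega (labeled (BKL m.+1))).
Implicit Types (a : n.-tuple nat) (P Q S : pre n) (M : X) (st : state m) (s : {set 'I_m}).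

(** Both structures are determined by [S] on the image of [g], which covers the numbers below
    [L]. *)
Lemma agree_onto (D : pred nat) N N' g S P Q L :
  agree D N g S P -> agree D N' g S Q -> L <= N -> L <= N' ->
  (forall y, y < L -> exists2 x, D x & g x = y) -> agree_below L P Q.
Proof.
move=> [po pr pl] [qo qr ql] LN LN' gL.
have lift a : all (gtn L) a -> exists2 a' : n.-tuple nat, all D a' & map_tuple g a' = a.
  move=> /allP aL; pose c y := xget 0 [set x | D x /\ g x = y]%classic.
  have cP y : y \in a -> D (c y) /\ g (c y) = y.
    move=> /aL /gL [x Dx xy].
    by apply: (@xgetPex _ 0 [set x | D x /\ g x = y]%classic); exists x.
  exists (map_tuple c a); first by apply/allP => _ /mapP [y /cP [? _] ->].
  apply: val_inj; rewrite /= -map_comp -[RHS]map_id; apply/eq_in_map => y.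
  by move=> /cP [].
split=> [i a /lift [a' Da' <-]|a /lift [a' Da' <-]|x i /gL [x' Dx' <-] iL].
- by rewrite qo // po.
- by rewrite qr // pr.
- by rewrite ql ?pl // (leq_trans iL).
Qed.

Lemma agree_shift (D : pred nat) N g S P Q L :
  agree D N g S P -> agree_below L P Q -> N <= L ->
  (forall x, D x -> g x < L) -> agree D N g S Q.
Proof.
move=> [po pr pl] [qo qr ql] NL gL.
have aL a : all D a -> all (gtn L) (map_tuple g a).
  by move=> /allP aD; apply/allP => _ /mapP [x /aD /gL ? ->].
split=> [i a Da|a Da|x i Dx iN].
- by rewrite qo ?aL // po.
- by rewrite qr ?aL // pr.
- by rewrite ql ?pl ?gL // (leq_trans iN).
Qed.

Definition empty_state P : state m := State P 0 0 (fun=> set0) (fun=> id).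

Lemma empty_state_valid P : valid (empty_state P).
Proof.
have no a : ~ all (below (empty_state P)) a by move=> /allP /(_ _ (head_mem a)).
split=> //; last by move=> i a /no.
split=> [i a /allP /no //|a /no //|[|x b] //].
Qed.

(** All elements come from a finite substructure of [P] containing 0, ..., [L - 1] and get empty
    support, so all [dom st s] coincide. The injections that the amalgam supplies for other [s] are
    replaced by the one for [set0]. *)
Lemma initial_state P L : good P -> exists st, valid st /\
  forall s, agree (dom st s) L (emb st s) (str st) P /\
    L <= depth st /\ forall y, y < L -> exists2 x, dom st s x & emb st s x = y.
Proof.
move=> gP; have [E LE cE] := goodB4 gP (iota 0 L).
have [||//|st' [[vst' _ Ld] ag _ sur su]] :=
  @amalgam m (empty_state P) set0 P E L (empty_state_valid P) gP cE.
- by move=> x /andP [].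
- by split=> // [i a /allP/(_ _ (head_mem a))|a /allP/(_ _ (head_mem a))].
have domE s : dom st' s =1 dom st' set0.
  move=> x; rewrite /dom; case xt : (x < top st') => //=.
  by rewrite su ?xt // !sub0set.
exists (State (str st') (top st') (depth st') (supp st') (fun=> emb st' set0)).
split; last first.
  move=> s; split; first last.
    split=> // y yL; have [|x Dx xy] := sur y; first by apply: LE; rewrite mem_iota.
    by exists x => //; rewrite -[dom _ _ _]/(dom st' s x) domE.
  have [o r l] := ag.
  split=> [i a|a|x i]; rewrite -?[dom _ _]/(dom st' s) ?(eq_all (domE s)) ?domE.
  - exact: o.
  - exact: r.
  - exact: l.
have [f sp l inj] := vst'; split=> // s x y.
rewrite -[x \in _]/(dom st' s x) -[y \in _]/(dom st' s y) !domE; exact: inj.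
Qed.

(** The part for [s] is completed to a model, which is then moved off [F] while keeping this part; a
    large finite piece of the result is amalgamated with [st]. *)
Lemma extension_step st s i (F : set X) : valid st -> nowhere_dense F ->
  exists st', [/\ valid st', extends st st', top st < top st', depth st < depth st' &
    [/\ exists2 x, dom st' s x & emb st' s x = i,
        exists2 x, below st' x & supp st' x = s &
        forall M, agree (dom st' s) (depth st') (emb st' s) (str st') (pre_of M) ->
          ~ F M]].
Proof.
move=> vst F0.
have [|Q gQ stQ] := @realize m (str st) (dom st s) (top st) (depth st)
  (emb st s) (fin_dom s vst) _ (v_inj vst (s := s)).
  by move=> x /andP [].
(* Any model agreeing with [Q] below [L0] still extends the part for [s]. Moreover [L0] is not a
   value of [emb st s], so making it one requires a new element, whose support is [s]. *)
pose L0 := (maxn (depth st) (\max_(x < top st) emb st s x)).+1.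
have embL x : x < top st -> emb st s x < L0.
  move=> xt; rewrite ltnS; apply: leq_trans (leq_maxr _ _).
  exact: (leq_bigmax (Ordinal xt)).
have dL : depth st < L0 by rewrite ltnS leq_maxl.
have [M1 M1L [L1 L1F]] := nowhere_dense_avoid (model gQ) L0 F0.
rewrite pre_of_model in M1L.
have stM1 := agree_shift stQ M1L (ltnW dL) (fun x Dx => embL x (proj1 (andP Dx))).
have gM1 := pre_of_good M1.
(* Large enough to include [i] and [L0] and to force agreement with [M1] below [L1]. *)
pose L2 := (maxn i (maxn L0 L1)).+1.
have [E LE cE] := goodB4 gM1 (iota 0 L2).
have yE y : y < L2 -> y \in E by move=> yL; apply: LE; rewrite mem_iota.
have domE x : dom st s x -> emb st s x \in E.
  by move=> /andP [/embL xL _]; apply: yE; rewrite /L2; lia.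
have dL2 : depth st <= L2 by rewrite /L2; lia.
have [st' [[vst' est' Ld] ag _ sur su]] := amalgam vst gM1 cE domE stM1 dL2.
have [x xt xs] : exists2 x, top st <= x < top st' & emb st' s x = L0.
  have [|x Dx xL] := sur L0; first by apply: yE; rewrite /L2; lia.
  exists x => //; rewrite andbC; have /andP [-> _] /= := Dx.
  rewrite leqNgt; apply/negP => xt; have := embL x xt.
  by rewrite -(ext_emb est' s xt) xL ltnn.
exists st'; split=> //.
- by have /andP [] := xt; exact: leq_ltn_trans.
- by apply: leq_trans Ld; rewrite /L2; lia.
split.
- by apply: sur; apply: yE; rewrite /L2; lia.
- by exists x; [case/andP: xt|exact: su].
- move=> M Mag; apply: L1F; apply: (agree_onto ag Mag).
  + by rewrite /L2; lia.
  + by apply: leq_trans Ld; rewrite /L2; lia.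
  + by move=> y yL; apply: sur; apply: yE; rewrite /L2; lia.
Qed.

Lemma generic_cube M0 (U : set X) (F : nat -> set X) : nbhs M0 U ->
  (forall i, nowhere_dense (F i)) ->
  exists N : {set 'I_m} -> X, [/\ forall s, U (N s), forall s i, ~ F i (N s) &
    forall s t, embeds (pre_of (N s)) (pre_of (N t)) <-> s \subset t].
Proof.
move=> /nbhsP_agree_below [L LU] F0.
have [st0 [vst0 st0P]] := initial_state L (pre_of_good M0).
have /choice [nx nxP] (p : state m * ({set 'I_m} * nat)) : exists st', valid p.1 ->
  [/\ valid st', extends p.1 st', top p.1 < top st', depth p.1 < depth st' &
    [/\ exists2 x, dom st' p.2.1 x & emb st' p.2.1 x = p.2.2,
        exists2 x, below st' x & supp st' x = p.2.1 &
        forall M, agree (dom st' p.2.1) (depth st') (emb st' p.2.1) (str st') (pre_of M) ->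
          ~ F p.2.2 M]].
  have [vp|nvp] := pselect (valid p.1); last by exists p.1 => /nvp.
  by have [st' ?] := extension_step p.2.1 p.2.2 vp (F0 p.2.2); exists st'.
(* Every pair of [s] and [i] is handled at stage [pickle (s, i)]; numbers that code no pair repeat
   the harmless task [(set0, 0)]. *)
pose task t : {set 'I_m} * nat := odflt (set0, 0) (unpickle t).
pose stt := fix stt t := if t is t'.+1 then nx (stt t', task t') else st0.
have vst t : valid (stt t) by elim: t => // t IH; have [] := nxP (stt t, task t) IH.
have sttP t := nxP (stt t, task t) (vst t).
have taskK s i : task (pickle (s, i)) = (s, i) by rewrite /task pickleK.
have est t : extends (stt t) (stt t.+1) by have [] := sttP t.
have topst t : t <= top (stt t).
  by elim: t => // t IH; have [_ _ + _ _] := sttP t; exact: leq_ltn_trans.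
have depst t : t <= depth (stt t).
  by elim: t => // t IH; have [_ _ _ + _] := sttP t; exact: leq_ltn_trans.
have taskP s i : exists t, [/\ exists2 x, dom (stt t) s x & emb (stt t) s x = i,
    exists2 x, below (stt t) x & supp (stt t) x = s &
    forall M, agree (dom (stt t) s) (depth (stt t)) (emb (stt t) s) (str (stt t)) (pre_of M) ->
      ~ F i M].
  exists (pickle (s, i)).+1; have [_ _ _ _] := sttP (pickle (s, i)).
  by rewrite -[stt (pickle (s, i)).+1]/(nx (stt (pickle (s, i)), task (pickle (s, i)))) taskK.
have surj s y : exists t x, dom (stt t) s x /\ emb (stt t) s x = y.
  by have [t [[x Dx xy] _ _]] := taskP s y; exists t, x.
have [N [gN agN subN embN]] := limit_family vst est topst depst surj.
exists (fun s => model (gN s)); split.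
- move=> s; apply: LU; rewrite pre_of_model.
  have [ag0 [Ld sur]] := st0P s.
  by apply: (agree_onto ag0 (agN s 0)).
- move=> s i; have [t [_ _]] := taskP s i; apply; rewrite pre_of_model.
  exact: agN.
- move=> s t; rewrite !pre_of_model; split; last exact: subN.
  (* An element of support exactly [s] must lie in the part for [t]. *)
  have [k [_ [x xk <-] _]] := taskP s 0 => /embN /(_ k x).
  by rewrite /dom -/(below _ _) xk subxx => /(_ isT).
Qed.

End GenericCube.

(** * The dimension of the space of models *)

Section Dimension.
Context (R : realType) (m : nat).
Notation X := (Mod_omega (labeled (BKL m.+1))).
Implicit Types (M : X) (C : set X).

Lemma gorbit_embeds M M' : gorbit M M' ->
  embeds (pre_of M) (pre_of M') /\ embeds (pre_of M') (pre_of M).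
Proof.
have iso_embeds (g : nat -> nat) (A B : structure (hat_lang (bkl_lang m.+1)) nat) :
    isomorphism g A B -> struct_embeds A B.
  move=> [gb gf gr]; exists g; split=> //; first exact: bij_inj.
  by move=> r a; rewrite gr.
move=> [g _ <-].
have gi : isomorphism (Sinf_fun g) (val M) (val (gact X g M)) by exact/logic_actP.
have [h hi _] := iso_inv gi.
by split; apply/struct_embedsP; [exact: iso_embeds gi|exact: iso_embeds hi].
Qed.

Lemma gorbit_refl M : gorbit M M.
Proof. by exists 1%g => //; exact: gact1. Qed.

(** Members of one orbit embed in each other, so an arrow can be tested on any representatives. *)
Lemma arrowP C (O O' : becker R C) M M' : val O = gorbit M -> val O' = gorbit M' ->
  arrow O O' <-> embeds (pre_of M) (pre_of M').
Proof.
move=> OM OM'; split=> [[x [x' []]]|MM'].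
  rewrite OM OM' => /gorbit_embeds [Mx _] /gorbit_embeds [_ x'M'].
  move=> /right_embedsP /struct_embedsP xx'.
  exact: embeds_trans Mx (embeds_trans xx' x'M').
exists M, M'; rewrite OM OM'; split; try exact: gorbit_refl.
by apply/right_embedsP/struct_embedsP.
Qed.

Lemma becker_bound C k : digraph_embeds (cube k) (becker R C) -> k <= m.
Proof.
move=> [f _ fE].
have /choice [N NE] s : exists M, val (f s) = gorbit M.
  by have [M _ ME] := set_mem (valP (f s)); exists M.
apply: (@cube_bound m k (fun s => pre_of (N s))) => [s|s t].
  exact: pre_of_good.
by rewrite -(arrowP (NE s) (NE t)) -fE.
Qed.

Lemma becker_cube C (N : {set 'I_m} -> X) : (forall s, C (N s)) ->
  (forall s t, embeds (pre_of (N s)) (pre_of (N t)) <-> s \subset t) ->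
  digraph_embeds (cube m) (becker R C).
Proof.
move=> CN NE.
have vN s : gorbit (N s) \in [set gorbit x | x in C]%classic.
  by apply/mem_set; exists (N s).
pose f (s : cube m) : becker R C := exist _ (gorbit (N s)) (vN s).
have fE (s t : cube m) : arrow s t <-> arrow (f s) (f t).
  by rewrite (@arrowP C (f s) (f t) (N s) (N t) erefl erefl) NE.
(* Injectivity comes from the reflexive arrows and antisymmetry of inclusion. *)
exists f => // s t fst; apply/eqP; rewrite eqEsubset; apply/andP; split.
  by apply/fE; rewrite fst; apply/fE; exact: subxx.
by apply/fE; rewrite -fst; apply/fE; exact: subxx.
Qed.

Lemma model_exists : exists M : X, True.
Proof.
have Sfin : fin_bkl (@Pre m.+1 (fun _ _ => 0) (fun=> 0) (fun _ _ => true)) (fun=> false).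
  split=> [i a /(_ _ (head_mem a))//|a /allP /(_ _ (head_mem a))//|[|x b]//].
by have [//|//|Q gQ _] := @realize m _ _ 0 0 id Sfin; exists (model gQ).
Qed.

Lemma nonmeager_setT : ~ meager [set: X]%classic.
Proof.
move=> [F F0 FT]; have [M _] := model_exists.
have [N [_ NF _]] := generic_cube (@filterT _ (nbhs M) _) F0.
by have [i _ /NF] := FT (N set0) I.
Qed.

Lemma baire_property_setT : baire_property [set: X]%classic.
Proof.
exists [set: X]%classic; first exact: openT.
exists (fun=> classical_sets.set0); last by move=> x [[]|[]].
move=> _; rewrite /nowhere_dense closure0; exact: interior0.
Qed.

(** [C] differs from an open [U] only inside the sets [F i]. As [C] is not meager, [U] is nonempty,
    and a cube in [U] avoiding every [F i] lies in [C]. *)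
Lemma generic_largest_cube C : ~ meager C -> baire_property C -> largest_cube R C m.
Proof.
move=> nC [U oU [F F0 CUF]]; split; last by move=> k; exact: becker_bound.
have [M UM] : exists M, U M.
  apply: contrapT => nU; apply: nC; exists F => // x Cx; apply: CUF.
  by left; split=> // Ux; apply: nU; exists x.
have [N [UN NF NE]] := generic_cube (open_nbhs_nbhs (conj oU UM)) F0.
apply: (@becker_cube C N) => // s; apply: contrapT => nCN.
by have [|i _ /NF] := CUF (N s); first by right.
Qed.

End Dimension.

Theorem theorem10 (R : realType) (n : nat) (n_ge1 : (1 <= n)%N) :
  is_dimensional R (Mod_omega (labeled (BKL n))) (Fin n.-1) /\
  locally_generically_dimensional R (Mod_omega (labeled (BKL n))) (Fin n.-1).
Proof.
case: n n_ge1 => // m _.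
have T : largest_cube R [set: Mod_omega (labeled (BKL m.+1))]%classic m.
  exact: (generic_largest_cube R (@nonmeager_setT m) (@baire_property_setT m)).
split; first exact: T.
split=> [C _ nC bC|e].
  by exists (Fin m); [exact: generic_largest_cube|exact: leqnn].
(* A generic lower bound applies to the whole space, whose cubes have dimension at most [m]. *)
move=> /(_ classical_sets.setT) [//|||d].
- exact: nonmeager_setT.
- exact: baire_property_setT.
case: d => [k [kT _]|[]]; last by exists m.
by case: e => // l /= lk; apply: leq_trans lk _; exact: becker_bound kT.
Qed.
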